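(* Let $k$ be an algebraically closed field, let $A=kQ^{\bowtie}/I$ be a bound quiver algebra, and let $M(w)$ be the loop module over $A$ of a loopstring $w$, with associated loop graph $\mathcal G^{\bowtie}$. Then the perfect matching lattice $\mathcal L(\mathcal G)$ of the loop graph is in bijection with the canonical submodule lattice $\mathcal L(M(w))$.
   Context: **Snake and loop graphs.** A tile is a square with edges $N,S,E,W$. A snake graph $\mathcal G=(G_1,\dots,G_n)$ is a sequence of tiles in the plane where each $G_{i+1}$ is glued either on the right of $G_i$ ($E(G_i)=W(G_{i+1})$) or on top of $G_i$ ($N(G_i)=S(G_{i+1})$). A run of consecutive tiles is a zig-zag if no tile of the run has its two neighbours in the run glued at opposite edges. Let $n\ge 3$ and let $\{G_{i+1},\dots,G_n\}$, $i\ge1$, be the maximal zig-zag ending at $G_n$; let $c$ be the edge of $G_n$ sharing no vertex with $G_{n-1}$ and $c'$ the North or East edge of $G_i$ that is a boundary edge of $\mathcal G$. Identify $c$ with $c'$ so that the North-East vertex of $G_n$ goes to the endpoint of $c'$ different from the North-East vertex of $G_i$, and the other endpoint of $c$ goes to the North-East vertex of $G_i$ (a loop with respect to $G_n$ and $G_i$). Dually (rotating by $180^\circ$), with $\{G_1,\dots,G_j\}$ the maximal zig-zag starting at $G_1$, one glues an edge of $G_1$ to an edge of $G_{j+1}$ (a loop with respect to $G_1$ and $G_{j+1}$). A loop graph $\mathcal G^{\bowtie}$ is obtained from $\mathcal G$ by performing one or both of these gluings. **Perfect matching lattice.** A perfect matching of a graph is a set of edges such that each vertex is incident to exactly one of them.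 $\mathcal L(\mathcal G)$ is the lattice of perfect matchings of $\mathcal G^{\bowtie}$; two matchings are joined by an edge of the Hasse diagram when they agree everywhere except on one tile, on which they have opposite matchings (pairs of opposite edges). **Loopstrings and loop graphs.** A loopstring is a word in $\{\rightarrow,\leftarrow,\hookrightarrow,\hookleftarrow\}$ with at most two letters from $\{\hookrightarrow,\hookleftarrow\}$ (direct, inverse loop), which are never the first or last letter, such that for each direct (resp. inverse) loop either all letters before it, or all letters after it, are inverse (resp. direct) arrows. We write $w=a_1u_1a_2u_2\cdots u_{n-1}a_n$ where $u_i$ are the letters and $a_i$ are vertices of the quiver placed between letters. Its plain string replaces $\hookrightarrow$ by $\rightarrow$ and $\hookleftarrow$ by $\leftarrow$. The associated snake graph has tiles $G_1,\dots,G_n$ with $G_{i+1}$ on the right of $G_i$ if ($i$ odd and $u_i$ direct) or ($i$ even and $u_i$ inverse), and on top of $G_i$ otherwise. A loop letter $u_i$ preceded only by arrows of opposite direction (left loop) gives a gluing of $G_1$ with $G_{i+1}$; a loop letter $u_i$ followed only by arrows of opposite direction (right loop) gives a gluing of $G_n$ with $G_i$. The result is the loop graph $\mathcal G^{\bowtie}$ associated to $w$. **Loop module.** $M(w)$ has a standard basis $e_1,\dots,e_n$, with $e_i$ at the vertex $a_i$. Direct (inverse) $u_i$ means that an arrow of the quiver sends $e_i$ to $e_{i+1}$ ($e_{i+1}$ to $e_i$). In addition, for a left loop letter $u_i$ there is an arrow acting with identity entry from $e_1$ to $e_{i+1}$ if $u_i=\hookleftarrow$, and from $e_{i+1}$ to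 $e_1$ if $u_i=\hookrightarrow$; for a right loop letter $u_i$, from $e_i$ to $e_n$ if $u_i=\hookleftarrow$, and from $e_n$ to $e_i$ if $u_i=\hookrightarrow$. All other matrix entries are $0$. **Canonical submodule lattice.** A canonical submodule of $M(w)$ is a submodule $N$ together with its canonical embedding (identity on non-zero components), i.e. a submodule spanned by a subset of the standard basis, remembering the positions; equivalently it is obtained from $M(w)$ by successively removing simples in the top. $\mathcal L(M(w))$ is the set of canonical submodules ordered by inclusion; two are joined by an edge of the Hasse diagram if they differ in exactly one basis element.
   Formalization: The lattice consists of the perfect matchings of the loop graph that come from a perfect matching of the snake graph by cutting the glued edges open; with all perfect matchings the claim fails (n=5, →↪←←: 12 matchings, 9 canonical submodules). *)

(* Defs.v *)
From HB Require Import structures.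
From mathcomp Require Import all_boot all_order all_algebra.
From mathcomp Require Import finmap.
From mathcomp Require Import monalg.

Set Implicit Arguments.
Unset Strict Implicit.
Unset Printing Implicit Defensive.

Import GRing.Theory.
Local Open Scope ring_scope.

(** * Loopstrings as words *)

Inductive letter := Dir | Inv | DirLoop | InvLoop.

Definition is_loop (l : letter) : bool :=
  match l with DirLoop | InvLoop => true | _ => false end.

(* The direction of the letter that replaces [l] in the plain string. *)
Definition is_direct (l : letter) : bool :=
  match l with Dir | DirLoop => true | _ => false end.

Definition opposite_arrow (loop l : letter) : bool :=
  match loop, l with DirLoop, Inv | InvLoop, Dir => true | _, _ => false end.

(* Everything is counted from 0: the word a_1 u_1 a_2 ... u_{n-1} a_n has
   n = (size w).+1, the letter u_{k+1} is [letter_at w k], and it stands between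
   the positions k and k.+1 of 'I_n. *)
Definition letter_at (w : seq letter) (k : nat) : letter := nth Dir w k.

Definition left_loop (w : seq letter) (k : nat) : bool :=
  is_loop (letter_at w k) && all (opposite_arrow (letter_at w k)) (take k w).

Definition right_loop (w : seq letter) (k : nat) : bool :=
  is_loop (letter_at w k) && all (opposite_arrow (letter_at w k)) (drop k.+1 w).

Definition is_loopword (w : seq letter) : bool :=
  [&& (count is_loop w <= 2)%N,
      ~~ is_loop (head Dir w),
      ~~ is_loop (last Dir w)
    & [forall k : 'I_(size w),
         is_loop (letter_at w k) ==> (left_loop w k || right_loop w k)]].

(** * Graphs glued from tiles *)

Definition corner : finType := (bool * bool)%type.
Definition cSW : corner := (false, false).
Definition cSE : corner := (true, false).
Definition cNW : corner := (false, true).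
Definition cNE : corner := (true, true).

(* (is the side vertical?, is it the North or East one?) *)
Definition side : finType := (bool * bool)%type.
Definition sS : side := (false, false).
Definition sN : side := (false, true).
Definition sW : side := (true, false).
Definition sE : side := (true, true).

Definition side_corners (s : side) : {set corner} :=
  if s.1 then [set (s.2, false); (s.2, true)]
  else [set (false, s.2); (true, s.2)].

Definition glue_class (T : finType) (r : rel T) (x : T) : {set T} :=
  [set y | connect (fun a b => r a b || r b a) x y].

(* Which corners, and which sides, of the tiles are identified; the
   identifications are the equivalence relations generated by these. *)
Record gluing (n : nat) := Gluing {
  corner_glue : rel ('I_n * corner);
  side_glue : rel ('I_n * side)
}.

Section TiledGraph.
Variables (n : nat) (g : gluing n).

Definition vertex_of (x : 'I_n * corner) : {set 'I_n * corner} :=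
  glue_class (corner_glue g) x.
Definition edge_of (x : 'I_n * side) : {set 'I_n * side} :=
  glue_class (side_glue g) x.

Definition vertices : {set {set 'I_n * corner}} := [set vertex_of x | x in setT].
Definition edges : {set {set 'I_n * side}} := [set edge_of x | x in setT].

Definition incident (v : {set 'I_n * corner}) (e : {set 'I_n * side}) : bool :=
  [exists x : 'I_n * side, (e == edge_of x) &&
     [exists p in side_corners x.2, v == vertex_of (x.1, p)]].

Definition perfect_matching (P : {set {set 'I_n * side}}) : bool :=
  (P \subset edges) &&
  [forall v in vertices, #|[set e in P | incident v e]| == 1%N].

Definition tile_edges (i : 'I_n) : {set {set 'I_n * side}} :=
  [set edge_of (i, s) | s in setT].
Definition NS_pair (i : 'I_n) := [set edge_of (i, sN); edge_of (i, sS)].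
Definition EW_pair (i : 'I_n) := [set edge_of (i, sE); edge_of (i, sW)].

(* [P] and [P'] agree off the tile [i], where they restrict to [A] and [A']. *)
Definition twist (i : 'I_n) (A A' P P' : {set {set 'I_n * side}}) : bool :=
  [&& P :\: tile_edges i == P' :\: tile_edges i,
      P :&: tile_edges i == A & P' :&: tile_edges i == A'].

Definition matching_edge (P P' : {set {set 'I_n * side}}) : bool :=
  [exists i, twist i (NS_pair i) (EW_pair i) P P'
          || twist i (EW_pair i) (NS_pair i) P P'].

(* The Hasse diagram is oriented as is usual for snake graphs: the direction in
   which a tile is twisted upwards alternates along the sequence of tiles.  The
   first tile G_1 (index 0) is twisted upwards from {E, W} to {N, S}. *)
Definition twist_up (P P' : {set {set 'I_n * side}}) : bool :=
  [exists i : 'I_n,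
     if odd i then twist i (NS_pair i) (EW_pair i) P P'
     else twist i (EW_pair i) (NS_pair i) P P'].

End TiledGraph.

(** * The snake graph and the loop graph of a word *)

Section LoopGraph.
Variable w : seq letter.
Let n := (size w).+1.

(* The tile k.+1 is glued on the right of the tile k (otherwise on top of it).
   The parity looks reversed because u_{k+1} is at index k. *)
Definition on_right (k : nat) : bool := ~~ odd k == is_direct (letter_at w k).

Definition snake_corners : rel ('I_n * corner) := fun x y =>
  (y.1 == x.1.+1 :> nat) &&
  ((x.2, y.2) \in if on_right x.1 then [:: (cNE, cNW); (cSE, cSW)]
                  else [:: (cNE, cSE); (cNW, cSW)]).

Definition snake_sides : rel ('I_n * side) := fun x y =>
  (y.1 == x.1.+1 :> nat) &&
  ((x.2, y.2) == if on_right x.1 then (sE, sW) else (sN, sS)).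

Definition snake_graph : gluing n := Gluing snake_corners snake_sides.

(* For a right loop at k, the side c of the last tile is glued to the side c' of
   the tile k; for a left loop at k, dually, a side of the first tile is glued to
   a side of the tile k.+1.  Here k (resp. k.+1) is the tile next to the maximal
   zig-zag ending at the last (resp. starting at the first) tile: see
   [right_loop_zigzag] and [left_loop_zigzag]. *)
Definition right_loop_sides (k : nat) : side * side :=
  (if on_right (size w).-1 then sE else sN, if on_right k then sN else sE).
Definition left_loop_sides (k : nat) : side * side :=
  (if on_right 0 then sW else sS, if on_right k then sS else sW).

Definition right_loop_corners (k : nat) : seq (corner * corner) :=
  [:: (cNE, if on_right k then cNW else cSE);
      (if on_right (size w).-1 then cSE else cNW, cNE)].
Definition left_loop_corners (k : nat) : seq (corner * corner) :=
  [:: (cSW, if on_right k then cSE else cNW);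
      (if on_right 0 then cNW else cSE, cSW)].

Definition loop_corners : rel ('I_n * corner) := fun x y =>
  [exists k : 'I_(size w),
     [&& right_loop w k, x.1 == size w :> nat, y.1 == k :> nat
       & (x.2, y.2) \in right_loop_corners k]
  || [&& left_loop w k, x.1 == 0%N :> nat, y.1 == k.+1 :> nat
       & (x.2, y.2) \in left_loop_corners k]].

Definition loop_sides : rel ('I_n * side) := fun x y =>
  [exists k : 'I_(size w),
     [&& right_loop w k, x.1 == size w :> nat, y.1 == k :> nat
       & (x.2, y.2) == right_loop_sides k]
  || [&& left_loop w k, x.1 == 0%N :> nat, y.1 == k.+1 :> nat
       & (x.2, y.2) == left_loop_sides k]].

Definition loop_graph : gluing n :=
  Gluing (fun x y => snake_corners x y || loop_corners x y)
         (fun x y => snake_sides x y || loop_sides x y).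

(* [P'] is obtained from [P] by cutting the loop graph open along the glued edges:
   an edge is in [P'] iff it is in [P], except that a glued edge outside [P] has
   exactly one of its two copies in [P'] (one in [P] has both). *)
Definition cut_open (P P' : {set {set 'I_n * side}}) : bool :=
  [forall x, ~~ [exists y, loop_sides x y || loop_sides y x] ==>
     ((edge_of snake_graph x \in P') == (edge_of loop_graph x \in P))] &&
  [forall x, forall y, loop_sides x y ==>
     (let c := edge_of snake_graph x \in P' in
      let c' := edge_of snake_graph y \in P' in
      (c || c') && ((c && c') == (edge_of loop_graph x \in P)))].

(* The perfect matchings forming the lattice of the loop graph: those which come
   from a perfect matching of the snake graph ("good" matchings).  A loop graph
   may have further perfect matchings, but with these the matchings are not
   connected by twists and do not form a lattice; the smallest examples have
   5 tiles.  Without loops every perfect matching is good. *)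
Definition good_matching (P : {set {set 'I_n * side}}) : bool :=
  perfect_matching loop_graph P &&
  [exists P', perfect_matching snake_graph P' && cut_open P P'].

Definition matching_le (P P' : {set {set 'I_n * side}}) : bool :=
  connect (fun P1 P2 => [&& good_matching P1, good_matching P2
                          & twist_up loop_graph P1 P2]) P P'.

End LoopGraph.

Arguments good_matching : clear implicits.
Arguments matching_le : clear implicits.

(* [on_right w i.-1 == on_right w i] says that the two neighbours of the tile i
   are glued to it at opposite sides. *)
Lemma right_loop_zigzag (w : seq letter) (k : nat) :
  right_loop w k -> (k.+1 < size w)%N ->
  on_right w k = on_right w k.+1 /\
  forall i, (k.+1 < i < size w)%N -> on_right w i.-1 != on_right w i.
Proof.
case/andP=> hk ha hs.
have H i : (k < i < size w)%N ->
    is_direct (letter_at w i) = ~~ is_direct (letter_at w k).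
  case/andP=> h1 h2; move/(all_nthP Dir)/(_ (i - k.+1)%N): ha.
  rewrite size_drop ltn_sub2r ?(leq_ltn_trans h1) // => /(_ isT).
  rewrite nth_drop subnKC // -/(letter_at w i).
  by case: (letter_at w k) hk => //; case: (letter_at w i).
split; first by rewrite /on_right (H k.+1) ?ltnSn ?hs //=; case: odd; case: is_direct.
case=> // i /andP[h1 h2] /=; rewrite /on_right (H i) ?(H i.+1) /=.
- by case: odd; case: is_direct.
- by rewrite h2 andbT ltnW.
- by rewrite -ltnS h1 ltnW.
Qed.

Lemma left_loop_zigzag (w : seq letter) (k : nat) :
  left_loop w k -> (0 < k < size w)%N ->
  on_right w k.-1 = on_right w k /\
  forall i, (0 < i < k)%N -> on_right w i.-1 != on_right w i.
Proof.
case/andP=> hk ha /andP[k0 hs].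
have H i : (i < k)%N -> is_direct (letter_at w i) = ~~ is_direct (letter_at w k).
  move=> h; move/(all_nthP Dir)/(_ i): ha.
  rewrite size_take hs => /(_ h); rewrite nth_take // -/(letter_at w i).
  by case: (letter_at w k) hk => //; case: (letter_at w i).
split.
  case: k k0 {hk ha hs} H => //= k _ H.
  by rewrite /on_right (H k) //=; case: odd; case: is_direct.
case=> // i /andP[_ h2] /=; rewrite /on_right (H i) ?(H i.+1) //; last exact: ltnW.
by rewrite /=; case: odd; case: is_direct.
Qed.

(** * Bound quivers *)

Record quiver := Quiver {
  qvertex : finType;
  qarrow : finType;
  src : qarrow -> qvertex;
  tgt : qarrow -> qvertex
}.

Section PathAlgebra.
Variables (k : fieldType) (Q : quiver).

Fixpoint composable (x : qvertex Q) (s : seq (qarrow Q)) : bool :=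
  if s is a :: s' then (src a == x) && composable (tgt a) s' else true.

(* A path is its starting vertex and its arrows in the order of traversal. *)
Definition qpath : choiceType :=
  {p : qvertex Q * seq (qarrow Q) | composable p.1 p.2}.

Definition path_src (p : qpath) : qvertex Q := (val p).1.
Definition path_arrows (p : qpath) : seq (qarrow Q) := (val p).2.
Definition path_tgt (p : qpath) : qvertex Q :=
  last (path_src p) [seq tgt a | a <- path_arrows p].

(* The path algebra is {malg k[qpath]} with the product [path_mul]. *)
Definition path_comp (p q : qpath) : option qpath :=
  if path_tgt p == path_src q
  then insub (path_src p, path_arrows p ++ path_arrows q) else None.

Definition path_mul (x y : {malg k[qpath]}) : {malg k[qpath]} :=
  \sum_(p <- msupp x) \sum_(q <- msupp y)
    if path_comp p q is Some r then << x@_p * y@_q *g r >> else 0.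

Definition is_ideal (I : {malg k[qpath]} -> Prop) : Prop :=
  [/\ I 0,
      forall x y, I x -> I y -> I (x + y),
      forall (c : k) x, I x -> I (c *: x)
    & forall x y, I x -> I (path_mul x y) /\ I (path_mul y x)].

(* The m-th power of the arrow ideal. *)
Definition arrow_ideal (m : nat) (x : {malg k[qpath]}) : Prop :=
  forall p, p \in msupp x -> (m <= size (path_arrows p))%N.

Definition admissible (I : {malg k[qpath]} -> Prop) : Prop :=
  [/\ is_ideal I,
      exists2 m, (2 <= m)%N & forall x, arrow_ideal m x -> I x
    & forall x, I x -> arrow_ideal 2 x].

End PathAlgebra.

(** * Loopstrings of a quiver and their modules *)

Section Loopstring.
Variable Q : quiver.

Definition joins (a : qarrow Q) (direct : bool) (x y : qvertex Q) : Prop :=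
  if direct then src a = x /\ tgt a = y else src a = y /\ tgt a = x.

(* The values of [larrow] (resp. [rarrow]) matter at left (resp. right) loops
   only.  The additional arrow of a loop has the direction opposite to [is_direct]. *)
Record loopstring := Loopstring {
  word : seq letter;
  vertex_at : 'I_(size word).+1 -> qvertex Q;
  arrow : 'I_(size word) -> qarrow Q;
  larrow : 'I_(size word) -> qarrow Q;
  rarrow : 'I_(size word) -> qarrow Q;
  wordP : is_loopword word;
  arrowP : forall k : 'I_(size word),
    joins (arrow k) (is_direct (letter_at word k))
      (vertex_at (inord k)) (vertex_at (inord k.+1));
  larrowP : forall k : 'I_(size word), left_loop word k ->
    joins (larrow k) (~~ is_direct (letter_at word k))
      (vertex_at ord0) (vertex_at (inord k.+1));
  rarrowP : forall k : 'I_(size word), right_loop word k ->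
    joins (rarrow k) (~~ is_direct (letter_at word k))
      (vertex_at (inord k)) (vertex_at ord_max)
}.

End Loopstring.

Section LoopModule.
Variables (k : fieldType) (Q : quiver) (w : loopstring Q).
Let n := (size (word w)).+1.

Definition goes (direct : bool) (x y p q : nat) : bool :=
  if direct then (p == x) && (q == y) else (p == y) && (q == x).

Definition identity_entry (a : qarrow Q) (p q : 'I_n) : bool :=
  [exists j : 'I_(size (word w)),
     let d := is_direct (letter_at (word w) j) in
     [|| (arrow j == a) && goes d j j.+1 p q,
         [&& left_loop (word w) j, larrow j == a & goes (~~ d) 0 j.+1 p q]
       | [&& right_loop (word w) j, rarrow j == a
           & goes (~~ d) j (size (word w)) p q]]].

(* The module is 'rV[k]_n, with [delta_mx 0 i] for its i-th basis vector, and
   arrows act on the right: v is sent to v *m M. *)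
Definition arrow_mx (a : qarrow Q) : 'M[k]_n :=
  \matrix_(p, q) (identity_entry a p q)%:R.

Definition vertex_mx (x : qvertex Q) : 'M[k]_n :=
  \matrix_(p, q) ((p == q) && (vertex_at p == x))%:R.

Definition path_mx (p : qpath Q) : 'M[k]_n :=
  foldl (fun A a => A *m arrow_mx a) (vertex_mx (path_src p)) (path_arrows p).

Definition action_mx (x : {malg k[qpath Q]}) : 'M[k]_n :=
  \sum_(p <- msupp x) x@_p *: path_mx p.

(* Modules over the quotient by [I] are modules over the path algebra
   annihilated by [I], with the same submodules. *)
Definition module_over (I : {malg k[qpath Q]} -> Prop) : Prop :=
  forall x, I x -> action_mx x = 0.

Definition submodule (U : 'M[k]_n) : Prop :=
  forall x : {malg k[qpath Q]}, stablemx U (action_mx x).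

Definition canonical_submodule (N : {set 'I_n}) : Prop :=
  submodule (\sum_(i in N) <<delta_mx 0 i : 'rV[k]_n>>)%MS.

End LoopModule.

Arguments module_over {k Q} w I.
Arguments canonical_submodule k {Q} w N.

Definition differ_by_one (T : finType) (N N' : {set T}) : bool :=
  #|(N :\: N') :|: (N' :\: N)| == 1%N.

Definition bijection_between (X Y : Type) (A : X -> Prop) (B : Y -> Prop)
    (f : X -> Y) : Prop :=
  [/\ forall x, A x -> B (f x),
      forall x x', A x -> A x' -> f x = f x' -> x = x'
    & forall y, B y -> exists2 x, A x & f x = y].

(* Main.v *)
(* Cut the loop graph open into its tiles. On the tile [i] put a pair of opposite
   sides, depending on [i \in N]. For two sides that are glued together, at least
   one belongs to the pair of its tile if and only if [N] satisfies the closure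
   condition of the corresponding arrow of the module. If so, the glued sides
   that both belong to their pairs, with the unglued sides that belong to theirs,
   form a matching: each gluing of two sides merges two pairs of covered vertices and
   removes one of the covering edges. Conversely a matching of a snake graph is
   taken apart tile by tile. As good matchings come from the snake graph, this is a
   bijection between them and the closed sets; twisting the tile [i] adds or
   removes [i], and inclusions of closed sets are refined to chains because the
   arrows of the module are acyclic. *)

From mathcomp Require Import all_boot all_order all_algebra.
From mathcomp Require Import finmap monalg.
From mathcomp Require Import zify.
(* [Defs] comes last because ssrfun also has a [left_loop] and a [right_loop]. *)
Require Import Defs.

Set Implicit Arguments.
Unset Strict Implicit.
Unset Printing Implicit Defensive.

(** Edges are classes of sides and change with every gluing, so matchings are handled as
    class-invariant predicates on the raw sides, which all graphs share. For a gluing of two sides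
    to merge exactly two pairs of vertices, the four corners involved must be four different
    vertices; this is certified by integer invariants of corners ([level] and its corrections), not
    by computing the classes. Gluing works for any two free sides with such ends. Ungluing is done
    only when the tile of one side becomes isolated: the side opposite to the glued one then tells
    what the gluing erased. Opening a loop isolates no tile, so this converse serves the snake graph
    alone, and the loops are reached through [cut_open]. To compare two matchings, the conjunction
    attached to a glued edge is turned into a sum modulo 2, which is legitimate because
    compatibility excludes that both patterns miss it. Injectivity and the description of twists
    then follow from one propagation along the snake. *)

Definition linked (T : Type) (r : rel T) : rel T := fun x y => r x y || r y x.

(** * Equivalence relations generated by a relation *)

Section Linked.
Variable T : finType.
Implicit Types (r : rel T) (x y : T).

Lemma linked_connect_sym r : connect_sym (linked r).
Proof. by apply: sym_connect_sym => x y; rewrite /linked orbC. Qed.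

Lemma glue_class_eq r x y :
  (glue_class r x == glue_class r y) = connect (linked r) x y.
Proof.
apply/eqP/idP => [e|h].
  have : y \in glue_class r y by rewrite inE connect0.
  by rewrite -e inE.
apply/setP => z; rewrite !inE.
exact: (same_connect (linked_connect_sym r) h).
Qed.

Lemma connect_invariant (V : Type) (f : T -> V) r x y :
  (forall u v, r u v -> f u = f v) -> connect (linked r) x y -> f x = f y.
Proof.
move=> h /connectP[s hs ->]; elim: s x hs => //= z s IH x /andP[hxz hs].
rewrite -(IH z hs); case/orP: hxz => /h //.
Qed.

Lemma connect_unlinked r x y :
  (forall z, ~~ linked r x z) -> connect (linked r) x y -> x = y.
Proof.
move=> h /connectP[[|z s] /=]; first by move=> _ ->.
by rewrite (negbTE (h z)).
Qed.

(** The only neighbour of a partner is the element itself, since [linked] is symmetric, so a walk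
    just goes back and forth between the two. *)
Lemma connect_partner r x y :
  (forall u v v', linked r u v -> linked r u v' -> v = v') ->
  connect (linked r) x y = (x == y) || linked r x y.
Proof.
move=> h; apply/idP/orP; last first.
  by case=> [/eqP->|/connect1 //]; rewrite connect0.
case/connectP => s; elim: s x => [|z s IH] x /=; first by move=> _ ->; left.
case/andP=> hxz hs ey; case: (IH z hs ey) => [/eqP<-|hzy]; first by right.
by left; apply/eqP/(h z) => //; rewrite /linked orbC.
Qed.

(* Adjoining to [r] the pairs (a, a') and (b, b') redirects the class of [a] to
   that of [a'] and the class of [b] to that of [b']. *)
Lemma connect_redirect r r' a b a' b' x y
    (E := connect (linked r))
    (f := fun z => if E z a then a' else if E z b then b' else z) :
  (forall u v, r' u v = [|| r u v, (u == a) && (v == a') | (u == b) && (v == b')]) ->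
  ~~ E a' a -> ~~ E a' b -> ~~ E b' a -> ~~ E b' b -> ~~ E b a ->
  connect (linked r') x y = E (f x) (f y).
Proof.
move=> hr' na'a na'b nb'a nb'b nba.
have sE : connect_sym (linked r) := @linked_connect_sym r.
have sE' : connect_sym (linked r') := @linked_connect_sym r'.
have sub u v : E u v -> connect (linked r') u v.
  apply: connect_sub => {}u {}v h; apply: connect1.
  by case/orP: h => h; rewrite /linked !hr' h ?orbT.
have aa' : connect (linked r') a a'.
  by apply: connect1; rewrite /linked hr' !eqxx ?orbT.
have bb' : connect (linked r') b b'.
  by apply: connect1; rewrite /linked hr' !eqxx ?orbT.
have tof z : connect (linked r') z (f z).
  rewrite /f; case: ifP => [/sub h|_]; first exact: connect_trans aa'.
  by case: ifP => [/sub h|_]; [exact: connect_trans bb'|exact: connect0].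
apply/idP/idP => [|h]; last first.
  apply: connect_trans (tof x) _; rewrite sE'; apply: connect_trans (tof y) _.
  by rewrite sE'; apply: sub.
(* The root of [f z] is an invariant of the new classes: it is constant along [r], and the
   non-equivalences assumed make it constant along the two new pairs. *)
rewrite /E -(root_connect sE) => h; apply/eqP; move: h.
apply: (connect_invariant (f := fun t => fingraph.root (linked r) (f t))) => u v;
  rewrite hr' => /or3P[huv||].
- have e z : E u z = E v z.
    by apply: (same_connect sE); apply: connect1; rewrite /linked huv.
  rewrite /f !e; case: ifP => // _; case: ifP => // _.
  by apply/eqP; rewrite (root_connect sE); apply: connect1; rewrite /linked huv.
- case/andP=> /eqP-> /eqP->.
  by rewrite /f /E connect0 -/E (negbTE na'a) (negbTE na'b).
case/andP=> /eqP-> /eqP->.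
by rewrite /f (negbTE nba) {1}/E connect0 (negbTE nb'a) (negbTE nb'b).
Qed.

End Linked.

(** * Matchings as predicates on sides *)

Section Gluing.
Variable n : nat.
Implicit Types (g : gluing n) (x : 'I_n * corner) (y z c d : 'I_n * side)
  (p : pred ('I_n * side)) (P : {set {set 'I_n * side}}).

Definition same_vertex g : rel ('I_n * corner) := connect (linked (corner_glue g)).
Definition same_edge g : rel ('I_n * side) := connect (linked (side_glue g)).

Lemma same_vertex_sym g : symmetric (same_vertex g).
Proof. exact: linked_connect_sym. Qed.
Lemma same_edge_sym g : symmetric (same_edge g).
Proof. exact: linked_connect_sym. Qed.

Lemma edge_of_eq g y z : (edge_of g y == edge_of g z) = same_edge g y z.
Proof. exact: glue_class_eq. Qed.
Lemma vertex_of_eq g x x' : (vertex_of g x == vertex_of g x') = same_vertex g x x'.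
Proof. exact: glue_class_eq. Qed.

(** A corner is an end of exactly two sides of its own tile, one horizontal and one vertical. *)
Definition hside x : 'I_n * side := (x.1, (false, x.2.2)).
Definition vside x : 'I_n * side := (x.1, (true, x.2.1)).
Definition ends y : pred ('I_n * corner) :=
  fun x => (x.1 == y.1) && (x.2 \in side_corners y.2).

Lemma endsE y x : ends y x = (y == hside x) || (y == vside x).
Proof.
case: y x => [i [[] t]] [j [u v]]; rewrite /ends /hside /vside /side_corners /=;
by rewrite !inE !xpair_eqE /= ?andbF ?orbF /= [i == j]eq_sym; case: (j == i) => //=;
  case: u v t => [] [] [].
Qed.

Definition meets g y x : bool := [exists x', ends y x' && same_vertex g x' x].

Lemma meets_same_vertex g y x x' :
  same_vertex g x x' -> meets g y x = meets g y x'.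
Proof.
move=> h; apply: eq_existsb => u; congr andb.
exact: (same_connect_r (@linked_connect_sym _ (corner_glue g)) h).
Qed.

Lemma incidentE g x y :
  incident g (vertex_of g x) (edge_of g y) =
  [exists z, same_edge g y z && meets g z x].
Proof.
apply: eq_existsb => z; rewrite edge_of_eq; case: same_edge => //=.
apply/existsP/existsP => [[q /andP[hq]]|[[i q] /andP[/andP[/eqP /= -> hq] h]]].
  rewrite vertex_of_eq same_vertex_sym => h.
  by exists (z.1, q); rewrite /ends /= eqxx hq.
by exists q; rewrite hq /= vertex_of_eq same_vertex_sym.
Qed.

Definition is_matching g p : Prop :=
  (forall y z, same_edge g y z -> p y = p z) /\
  (forall x, exists2 y, meets g y x && p y &
     forall z, meets g z x -> p z -> same_edge g y z).

Lemma perfect_matchingP g P :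
  perfect_matching g P <->
  P \subset edges g /\ is_matching g (fun y => edge_of g y \in P).
Proof.
split=> [/andP[sP /forall_inP hP]|[sP [hp hP]]].
  split=> //; split=> [y z|x]; first by rewrite -edge_of_eq => /eqP->.
  have /cards1P[e he] := hP _ (imset_f (vertex_of g) (in_setT x)).
  have eE z : meets g z x -> edge_of g z \in P -> edge_of g z = e.
    move=> h1 h2; apply/eqP; rewrite -in_set1 -he inE h2 incidentE.
    by apply/existsP; exists z; rewrite h1 andbT; apply: connect0.
  have : e \in [set e] by rewrite set11.
  rewrite -he inE => /andP[heP].
  have /imsetP[y _ ey] := subsetP sP _ heP.
  rewrite ey incidentE => /existsP[z /andP[hyz hz]].
  have ez : edge_of g z = e by apply/eqP; rewrite ey edge_of_eq same_edge_sym.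
  exists z; rewrite ?hz ?ez // => z' h1 h2.
  by rewrite -edge_of_eq (eE z') ?ez.
rewrite /perfect_matching sP; apply/forall_inP => v /imsetP[x _ ->].
have [y /andP[hy py] uy] := hP x; apply/cards1P; exists (edge_of g y).
apply/setP => e; rewrite !inE; apply/andP/eqP => [[he]|->]; last first.
  by split=> //; rewrite incidentE; apply/existsP; exists y;
    rewrite hy /same_edge connect0.
have /imsetP[z _ ez] := subsetP sP _ he; rewrite ez incidentE.
case/existsP=> z' /andP[zz' hz']; apply/eqP; rewrite eq_sym edge_of_eq.
apply: connect_trans (uy z' hz' _) _;
  last by rewrite -/(same_edge g _ _) same_edge_sym.
by rewrite -(hp _ _ zz') -ez.
Qed.

Definition edge_set g p : {set {set 'I_n * side}} := [set edge_of g y | y in p].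

Lemma mem_edge_set g p y :
  (forall y z, same_edge g y z -> p y = p z) -> (edge_of g y \in edge_set g p) = p y.
Proof.
move=> hp; apply/imsetP/idP => [[z hz /eqP]|hy]; last by exists y.
by rewrite edge_of_eq => /hp->.
Qed.

Lemma edge_set_sub g p : edge_set g p \subset edges g.
Proof. by apply/subsetP => _ /imsetP[y _ ->]; apply: imset_f. Qed.

Lemma edge_setK g P :
  P \subset edges g -> edge_set g (fun y => edge_of g y \in P) = P.
Proof.
move=> sP; apply/setP => e; apply/imsetP/idP => [[y hy ->] //|he].
have /imsetP[y _ ey] := subsetP sP _ he; exists y => //; by rewrite unfold_in -ey.
Qed.

Lemma eq_edge_set g p p' : p =1 p' -> edge_set g p = edge_set g p'.
Proof.
move=> h; apply/setP => e; apply/imsetP/imsetP => -[y hy ->]; exists y => //.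
- by rewrite unfold_in -h.
by rewrite unfold_in h.
Qed.

End Gluing.

(** * Gluing two sides *)

Section GlueStep.
Variable n : nat.
Implicit Types (g : gluing n) (x : 'I_n * corner) (y z c d : 'I_n * side)
  (p : pred ('I_n * side)).

Definition simple_sides g : Prop := forall u v v',
  linked (side_glue g) u v -> linked (side_glue g) u v' -> v = v'.

Lemma same_edgeE g y z :
  simple_sides g -> same_edge g y z = (y == z) || linked (side_glue g) y z.
Proof. by move=> h; apply: connect_partner. Qed.

(* [g'] is [g] with the side [c], with ends [a] and [b], glued to the side [d],
   with ends [a'] and [b']. *)
Record glue_step g g' c d (a b a' b' : 'I_n * corner) : Prop := GlueStep {
  step_corners : forall u v, corner_glue g' u v =
    [|| corner_glue g u v, (u == a) && (v == a') | (u == b) && (v == b')];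
  step_sides : forall u v, side_glue g' u v =
    side_glue g u v || (u == c) && (v == d);
  step_ends_c : forall x, ends c x = (x == a) || (x == b);
  step_ends_d : forall x, ends d x = (x == a') || (x == b');
  step_free_c : forall z, ~~ linked (side_glue g) c z;
  step_free_d : forall z, ~~ linked (side_glue g) d z;
  step_simple : simple_sides g;
  step_vertices : exists2 nu : 'I_n * corner -> nat,
    forall u v, corner_glue g u v -> nu u = nu v
    & uniq [:: nu a; nu b; nu a'; nu b']
}.

Definition glue_pred c d p : pred ('I_n * side) :=
  fun y => if (y == c) || (y == d) then p c && p d else p y.

(** Lets what is proved at the vertex merged from [a] and [a'] be reused at the one merged from [b]
    and [b']. *)
Lemma glue_step_sym g g' c d a b a' b' :
  glue_step g g' c d a b a' b' -> glue_step g g' c d b a b' a'.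
Proof.
case=> h1 h2 h3 h4 h5 h6 h7 [nu h8 h9]; split=> //.
- by move=> u v; rewrite h1 [in LHS]orbCA orbC orbCA -!orbA orbCA.
- by move=> u; rewrite h3 orbC.
- by move=> u; rewrite h4 orbC.
exists nu => //; move: h9; rewrite /= !inE !negb_or !andbT.
case/andP=> /and3P[e1 e2 e3] /andP[/andP[e4 e5] e6].
by rewrite eq_sym e1 e5 e4 e3 e2 eq_sym e6.
Qed.

Section Step.
Variables (g g' : gluing n) (c d : 'I_n * side) (a b a' b' : 'I_n * corner).
Hypothesis st : glue_step g g' c d a b a' b'.

(** [nu] is constant on the vertices of [g], so four different values mean four different
    vertices. *)
Lemma step_distinct :
  [/\ [/\ ~~ same_vertex g b a, ~~ same_vertex g a' a & ~~ same_vertex g b' a],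
      ~~ same_vertex g a' b, ~~ same_vertex g b' b & ~~ same_vertex g b' a'].
Proof.
have [nu h] := step_vertices st.
rewrite /= !inE !negb_or andbT => /and3P[/and3P[h1 h2 h3] /andP[h4 h5] h6].
split; first split; apply/negP => /(connect_invariant h) e;
  [move: h1|move: h2|move: h3|move: h4|move: h5|move: h6]; by rewrite e eqxx.
Qed.

Lemma step_same_vertex x x'
    (f := fun z => if same_vertex g z a then a'
                   else if same_vertex g z b then b' else z) :
  same_vertex g' x x' = same_vertex g (f x) (f x').
Proof.
have [[h1 h2 h3] h4 h5 h6] := step_distinct.
exact: (connect_redirect _ _ (step_corners st)).
Qed.

Lemma same_vertex_trans x1 x2 x3 :
  same_vertex g x1 x2 -> same_vertex g x2 x3 -> same_vertex g x1 x3.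
Proof. exact: connect_trans. Qed.

Lemma step_meets_other x y :
  ~~ same_vertex g x a -> ~~ same_vertex g x a' ->
  ~~ same_vertex g x b -> ~~ same_vertex g x b' ->
  meets g' y x = meets g y x.
Proof.
move=> xa xa' xb xb'; apply: eq_existsb => u; case: ends => //=.
rewrite step_same_vertex (negbTE xa) (negbTE xb).
have far v v' : same_vertex g u v -> ~~ same_vertex g x v ->
    ~~ same_vertex g x v' -> same_vertex g v' x = same_vertex g u x.
  move=> uv xv xv'; rewrite same_vertex_sym (negbTE xv').
  apply/esym/negbTE; apply: contra xv => ux.
  by apply: same_vertex_trans uv; rewrite same_vertex_sym.
by case: ifP => [/far->//|_]; case: ifP => [/far->|].
Qed.

Lemma step_meets x y :
  same_vertex g x a || same_vertex g x a' ->
  meets g' y x = meets g y a || meets g y a'.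
Proof.
have [[h1 h2 h3] h4 h5 h6] := step_distinct => hx.
have sep u : same_vertex g u a' -> same_vertex g u b = false.
  move=> ua'; apply/negbTE; apply: contra h4; apply: same_vertex_trans.
  by rewrite same_vertex_sym.
have key u : same_vertex g' u x = same_vertex g u a || same_vertex g u a'.
  rewrite step_same_vertex; set v := (X in same_vertex g _ X).
  have va' : same_vertex g v a'.
    by rewrite {}/v; case: ifP hx => [|_ /= xa'];
      [rewrite /same_vertex connect0|rewrite sep].
  have vE t : same_vertex g t v = same_vertex g t a'.
    exact: (same_connect_r (@linked_connect_sym _ (corner_glue g)) va').
  rewrite {}vE; case: ifP => [_|ua]; first by rewrite /same_vertex connect0.
  case: ifP => //= ub; rewrite (negbTE h6); apply/esym/negbTE.
  by apply/negP => /sep; rewrite ub.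
apply/existsP/orP => [[u /andP[hu]]|].
  by rewrite key => /orP[h|h]; [left|right]; apply/existsP; exists u; rewrite hu.
by case=> /existsP[u /andP[hu h]]; exists u; rewrite hu key h ?orbT.
Qed.

Lemma step_linked u v : linked (side_glue g') u v =
  [|| linked (side_glue g) u v, (u == c) && (v == d) | (u == d) && (v == c)].
Proof.
rewrite /linked !(step_sides st).
by rewrite [(v == c) && _]andbC -!orbA; congr orb; rewrite orbCA.
Qed.

Lemma step_neq : c != d.
Proof.
have [[h1 h2 h3] h4 h5 h6] := step_distinct.
apply/eqP => e; have : ends c a by rewrite (step_ends_c st) eqxx.
rewrite e (step_ends_d st) => /orP[]/eqP e'.
  by move: h2; rewrite -e' /same_vertex connect0.
by move: h3; rewrite -e' /same_vertex connect0.
Qed.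

Lemma glue_step_simple : simple_sides g'.
Proof.
have cd := negbTE step_neq.
have fc z : linked (side_glue g) c z = false by apply/negbTE/(step_free_c st).
have fd z : linked (side_glue g) d z = false by apply/negbTE/(step_free_d st).
move=> u v v'; rewrite !step_linked.
case/or3P=> [h|/andP[/eqP eu /eqP ->]|/andP[/eqP eu /eqP ->]].
- case/or3P=> [/(step_simple st h)//|/andP[/eqP eu]|/andP[/eqP eu]].
    by move: h; rewrite eu fc.
  by move: h; rewrite eu fd.
- by rewrite eu fc eqxx cd /= orbF => /eqP.
by rewrite eu fd eqxx [d == c]eq_sym cd /= => /eqP.
Qed.

Lemma step_same_edge y z : same_edge g' y z =
  [|| same_edge g y z, (y == c) && (z == d) | (y == d) && (z == c)].
Proof.
rewrite !same_edgeE; [|exact: (step_simple st)|exact: glue_step_simple].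
by rewrite step_linked !orbA.
Qed.

Lemma step_same_edge_c z : same_edge g c z = (z == c).
Proof.
rewrite same_edgeE; last exact: (step_simple st).
by rewrite (negbTE (step_free_c st z)) orbF eq_sym.
Qed.
Lemma step_same_edge_d z : same_edge g d z = (z == d).
Proof.
rewrite same_edgeE; last exact: (step_simple st).
by rewrite (negbTE (step_free_d st z)) orbF eq_sym.
Qed.

Lemma step_meets_c x : meets g c x = same_vertex g x a || same_vertex g x b.
Proof.
apply/existsP/orP => [[u /andP[]]|].
  by rewrite (step_ends_c st) => /orP[]/eqP->; rewrite same_vertex_sym; [left|right].
by case=> h; [exists a|exists b];
  rewrite same_vertex_sym h (step_ends_c st) eqxx ?orbT.
Qed.
Lemma step_meets_d x : meets g d x = same_vertex g x a' || same_vertex g x b'.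
Proof.
apply/existsP/orP => [[u /andP[]]|].
  by rewrite (step_ends_d st) => /orP[]/eqP->; rewrite same_vertex_sym; [left|right].
by case=> h; [exists a'|exists b'];
  rewrite same_vertex_sym h (step_ends_d st) eqxx ?orbT.
Qed.

(* If [p] contains both sides, the glued edge covers the glued vertices; otherwise
   the glued edge is dropped and the partner of the side outside [p] remains. *)
Lemma glue_step_covered p x :
  is_matching g p -> p c || p d -> same_vertex g x a || same_vertex g x a' ->
  exists2 y, meets g' y x && glue_pred c d p y &
     forall z, meets g' z x -> glue_pred c d p z -> same_edge g' y z.
Proof.
move=> [_ hp] hcd hx; have [[h1 h2 h3] h4 h5 h6] := step_distinct.
have cd := negbTE step_neq.
have mca : meets g c a by rewrite step_meets_c /same_vertex connect0.
have mda' : meets g d a' by rewrite step_meets_d /same_vertex connect0.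
have mca' : meets g c a' = false by rewrite step_meets_c (negbTE h2) (negbTE h4).
have mda : meets g d a = false.
  by rewrite step_meets_d -![same_vertex g a _]same_vertex_sym (negbTE h2)
    (negbTE h3).
have uc z : p c -> meets g z a -> p z -> z = c.
  move=> pc hz pz; have [y _ uy] := hp a.
  have yz := uy z hz pz; have yc := uy c mca pc.
  apply/eqP; rewrite -step_same_edge_c same_edge_sym.
  by apply: connect_trans yc; rewrite -/(same_edge _ _ _) same_edge_sym.
have ud z : p d -> meets g z a' -> p z -> z = d.
  move=> pd hz pz; have [y _ uy] := hp a'.
  have yz := uy z hz pz; have yd := uy d mda' pd.
  apply/eqP; rewrite -step_same_edge_d same_edge_sym.
  by apply: connect_trans yd; rewrite -/(same_edge _ _ _) same_edge_sym.
have pc_pd z : glue_pred c d p z -> p z.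
  by rewrite /glue_pred; case: eqP => [->|_] /=; [|case: eqP => [->|//]]; case/andP.
case pc: (p c); case pd: (p d); move: hcd; rewrite pc pd //= => _.
- exists c; first by rewrite step_meets // mca /glue_pred eqxx pc pd.
  move=> z; rewrite step_meets // => /orP[] hz /pc_pd pz.
    by rewrite (uc z pc hz pz) /same_edge connect0.
  by rewrite (ud z pd hz pz) step_same_edge !eqxx orbT.
- have [y /andP[my py] uy] := hp a'.
  have gy : glue_pred c d p y.
    rewrite /glue_pred; case: eqP => [ey|_] /=; first by rewrite ey mca' in my.
    by case: eqP => // ey; rewrite ey pd in py.
  exists y; first by rewrite step_meets // my orbT.
  move=> z; rewrite step_meets // => /orP[] hz gz.
    have := uc z pc hz (pc_pd _ gz) => ez.
    by move: gz; rewrite ez /glue_pred eqxx pd andbF.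
  by rewrite step_same_edge (uy z hz (pc_pd _ gz)).
have [y /andP[my py] uy] := hp a.
have gy : glue_pred c d p y.
  rewrite /glue_pred orbC; case: eqP => [ey|_] /=; first by rewrite ey mda in my.
  by case: eqP => // ey; rewrite ey pc in py.
exists y; first by rewrite step_meets // my.
move=> z; rewrite step_meets // => /orP[] hz gz.
  by rewrite step_same_edge (uy z hz (pc_pd _ gz)).
have := ud z pd hz (pc_pd _ gz) => ez.
by move: gz; rewrite ez /glue_pred eqxx orbT pc.
Qed.

End Step.

Lemma glue_step_matching g g' c d a b a' b' p :
  glue_step g g' c d a b a' b' -> is_matching g p -> p c || p d ->
  is_matching g' (glue_pred c d p).
Proof.
move=> st hp hcd; have st' := glue_step_sym st.
have [hp1 hp2] := hp; split=> [y z|x].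
  rewrite (step_same_edge st) /glue_pred => /or3P[hyz||].
  - have ec t : same_edge g t c = (t == c) by rewrite same_edge_sym
      (step_same_edge_c st).
    have ed t : same_edge g t d = (t == d) by rewrite same_edge_sym
      (step_same_edge_d st).
    rewrite -!ec -!ed.
    have yzE t : same_edge g y t = same_edge g z t.
      exact: (same_connect (@linked_connect_sym _ (side_glue g)) hyz).
    rewrite !yzE.
    by case: ifP => // _; apply: hp1.
  - by case/andP=> /eqP-> /eqP->; rewrite !eqxx orbT.
  by case/andP=> /eqP-> /eqP->; rewrite !eqxx orbT.
case xa: (same_vertex g x a || same_vertex g x a');
  first exact: (glue_step_covered st).
case xb: (same_vertex g x b || same_vertex g x b');
  first exact: (glue_step_covered st').
move/negbT: xa; move/negbT: xb; rewrite !negb_or => /andP[xb xb'] /andP[xa xa'].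
have [y /andP[my py] uy] := hp2 x.
(* Away from the glued corners neither [c] nor [d] is incident, so [glue_pred] changes nothing
   there. *)
have gE z : meets g z x -> glue_pred c d p z = p z.
  rewrite /glue_pred; case: eqP => [->|_] /=; last case: eqP => [->|//].
    by rewrite (step_meets_c st) (negbTE xa) (negbTE xb).
  by rewrite (step_meets_d st) (negbTE xa') (negbTE xb').
exists y; first by rewrite (step_meets_other st) // my gE.
move=> z; rewrite (step_meets_other st) // => mz; rewrite gE // => pz.
by rewrite (step_same_edge st) uy.
Qed.

End GlueStep.

(** * Ungluing an isolated tile *)

Section Ungluing.
Variable n : nat.
Implicit Types (g : gluing n) (x : 'I_n * corner) (y z c d : 'I_n * side)
  (p : pred ('I_n * side)).

Definition isolated g (j : 'I_n) : Prop :=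
  (forall x x', x.1 = j -> same_vertex g x x' -> x = x') /\
  (forall y z, y.1 = j -> same_edge g y z -> y = z).

Lemma isolated_meets g j y x : isolated g j -> x.1 = j -> meets g y x = ends y x.
Proof.
move=> [iso _] hx; apply/existsP/idP => [[u /andP[hu]]|hu].
  by rewrite same_vertex_sym => /(iso _ _ hx) ->.
by exists x; rewrite hu /same_vertex connect0.
Qed.

Lemma isolated_meets_tile g j y x :
  isolated g j -> x.1 != j -> meets g y x -> y.1 != j.
Proof.
move=> [iso _] hx /existsP[u /andP[/andP[/eqP uy _] ux]]; rewrite -uy.
by apply: contra hx => /eqP h; rewrite -(iso _ _ h ux) h.
Qed.

Section Unglue.
Variables (g g' : gluing n) (c d : 'I_n * side).
Variables (a b a' b' : 'I_n * corner) (p' : pred ('I_n * side)).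
Hypothesis st : glue_step g g' c d a b a' b'.
Hypothesis cd : c.1 != d.1.
Hypothesis iso : isolated g d.1.
Hypothesis mp' : is_matching g' p'.

Let opp : 'I_n * side := (d.1, (d.2.1, ~~ d.2.2)).
Let perp (u : bool) : 'I_n * side := (d.1, (~~ d.2.1, u)).

Let a_tile : a.1 = c.1.
Proof.
have : ends c a by rewrite (step_ends_c st) eqxx.
by case/andP=> /eqP.
Qed.

Let a'_tile : a'.1 = d.1.
Proof.
have : ends d a' by rewrite (step_ends_d st) eqxx.
by case/andP=> /eqP.
Qed.

Let ends_meets y x : ends y x -> meets g' y x.
Proof. by move=> h; apply/existsP; exists x; rewrite h /same_vertex connect0. Qed.

Let iso_meets y x : x.1 = d.1 -> meets g y x = ends y x.
Proof. exact: isolated_meets. Qed.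

Let iso_meets_tile y x : x.1 != d.1 -> meets g y x -> y.1 != d.1.
Proof. exact: isolated_meets_tile. Qed.

Let iso_same_edge' y z : y.1 = d.1 -> z.1 = d.1 -> same_edge g' y z -> y = z.
Proof.
move=> hy hz; rewrite (step_same_edge st) => /or3P[/(iso.2 _ _ hy) //||].
  by case/andP=> /eqP ey _; move: cd; rewrite -ey hy eqxx.
by case/andP=> _ /eqP ez; move: cd; rewrite -ez hz eqxx.
Qed.

Let tile_unique x y z : y.1 = d.1 -> z.1 = d.1 -> meets g' y x -> meets g' z x ->
  p' y -> p' z -> y = z.
Proof.
move=> hy hz my mz py pz; apply: iso_same_edge' => //.
have [t _ ut] := mp'.2 x; have ty := ut y my py; have tz := ut z mz pz.
by rewrite same_edge_sym in ty; apply: connect_trans ty tz.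
Qed.

(** The ends of [opp] are untouched by the gluing: the only sides incident there are [opp] and one
    perpendicular side, and exactly one of them is chosen. *)
Let perpE u : p' (perp u) = ~~ p' opp.
Proof.
pose x : 'I_n * corner := (d.1, if d.2.1 then (~~ d.2.2, u) else (u, ~~ d.2.2)).
have xE y : ends y x = (y == opp) || (y == perp u).
  rewrite endsE /x /opp /perp /hside /vside /=.
  by case: d.2 => [[] t] //=; rewrite orbC.
have dx : ends d x = false.
  rewrite xE /opp /perp; case: (d) => j [s t] /=.
  by apply/negbTE; rewrite !xpair_eqE; case: s t => [] []; rewrite ?andbF.
have far v : ends d v -> ~~ same_vertex g x v.
  by move=> hv; apply/negP => /(iso.1 x _ erefl) e; rewrite e hv in dx.
have farc v : ends c v -> ~~ same_vertex g x v.
  move=> /andP[/eqP hv _]; apply/negP => /(iso.1 x _ erefl) e.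
  by move: cd; rewrite -hv -e eqxx.
have mE y : meets g' y x = (y == opp) || (y == perp u).
  rewrite -xE -iso_meets //; apply: (step_meets_other st).
  - by apply: farc; rewrite (step_ends_c st) eqxx.
  - by apply: far; rewrite (step_ends_d st) eqxx.
  - by apply: farc; rewrite (step_ends_c st) eqxx orbT.
  by apply: far; rewrite (step_ends_d st) eqxx orbT.
case po: (p' opp); last first.
  have [y /andP[]] := mp'.2 x.
  by rewrite mE => /orP[]/eqP-> // py; rewrite po in py.
apply/negbTE/negP => pu.
have : opp = perp u by apply: (@tile_unique x) => //; rewrite mE eqxx ?orbT.
by case; case: d.2.1.
Qed.

Let p'cd : p' c = p' d.
Proof. by apply: mp'.1; rewrite (step_same_edge st) !eqxx orbT. Qed.

Let perp_at x : ends d x -> exists u, ends (perp u) x.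
Proof.
case: x => i [u v] /andP[/= /eqP-> h]; rewrite /ends /perp /=.
exists (if d.2.1 then v else u); rewrite eqxx /=.
by move: h; rewrite /side_corners; case: d.2 => [[] t] /=;
  rewrite !inE !xpair_eqE; case: u v t => [] [] [].
Qed.

(** If [opp] were missing, both perpendicular sides would be present by [perpE], and one of them
    shares an end with [d]. *)
Let d_opp : p' d -> p' opp.
Proof.
move=> pd; apply/negPn/negP => po.
have da' : ends d a' by rewrite (step_ends_d st) eqxx.
have [u ua'] := perp_at da'.
have : d = perp u.
  by apply: (@tile_unique a') => //; try exact: ends_meets; rewrite perpE.
by rewrite /perp; case: (d) => j [s t] /= []; case: s.
Qed.

(** Once isolated, the tile of [d] must carry a pair of opposite sides, and the side opposite to
    [d], which the gluing left alone, dictates which pair. If that side is absent, the perpendicular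
    sides cover both merged vertices from the tile of [d], so after the separation [c] has to be
    restored to cover its own ends. *)
Definition unglue_pred : pred ('I_n * side) :=
  fun y => if y == d then p' (d.1, (d.2.1, ~~ d.2.2))
           else if y == c then p' c || ~~ p' (d.1, (d.2.1, ~~ d.2.2)) else p' y.

Lemma glue_unglue_pred : p' =1 glue_pred c d unglue_pred.
Proof.
have cNd : (c == d) = false by apply: contraNF cd => /eqP->.
move=> y; rewrite /glue_pred /unglue_pred !eqxx cNd -/opp.
have -> : (p' c || ~~ p' opp) && p' opp = p' c.
  by have := d_opp; rewrite -p'cd; case: (p' c); case: (p' opp) => // /(_ isT).
by case: eqP => [->|_] //=; case: eqP => [->|//]; rewrite p'cd.
Qed.

(** The opposite side brings [d] if it is present and [c] if it is absent. This disjunction becomes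
    the compatibility of the set read off the matching. *)
Lemma unglue_pred_or : unglue_pred c || unglue_pred d.
Proof.
have cNd : (c == d) = false by apply: contraNF cd => /eqP->.
by rewrite /unglue_pred !eqxx cNd -orbA orNb orbT.
Qed.

Lemma unglue_tile s u :
  unglue_pred (d.1, (s, u)) = (s == d.2.1) (+) ~~ p' (d.1, (d.2.1, ~~ d.2.2)).
Proof.
have pc v : ((d.1, v) == c) = false.
  by apply: contraNF cd => /eqP <-.
have dE : ((d.1, (s, u)) == d) = (s == d.2.1) && (u == d.2.2).
  by case: (d) => i [t t']; rewrite !xpair_eqE eqxx.
rewrite /unglue_pred pc dE -/opp; case: (s =P d.2.1) => [->|ns] /=.
  rewrite negbK; case: eqP => // nu.
  by have -> : u = ~~ d.2.2 by case: (u) d.2.2 nu => [] [].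
have -> : s = ~~ d.2.1 by case: (s) d.2.1 ns => [] [].
exact: perpE.
Qed.

Lemma unglue_covered x : same_vertex g x a ->
  exists2 y, meets g y x && unglue_pred y &
     forall z, meets g z x -> unglue_pred z -> same_edge g y z.
Proof.
move=> xa.
have a_far : a.1 != d.1 by rewrite a_tile.
suff [y my uy] : exists2 y, meets g y a && unglue_pred y &
     forall z, meets g z a -> unglue_pred z -> same_edge g y z.
  exists y; first by rewrite (meets_same_vertex _ xa).
  by move=> z; rewrite (meets_same_vertex _ xa); apply: uy.
have mca : meets g c a by rewrite (step_meets_c st) /same_vertex connect0.
have aE y : meets g' y a = meets g y a || meets g y a'.
  by rewrite (step_meets st) // /same_vertex connect0.
have dN y : y.1 != d.1 -> (y == d) = false by move=> h; apply: contraNF h => /eqP->.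
have edge_off y z : y.1 != d.1 -> z.1 != d.1 -> same_edge g' y z -> same_edge g y z.
  by move=> hy hz; rewrite (step_same_edge st) (dN y hy) (dN z hz) !andbF /= !orbF.
have da' : ends d a' by rewrite (step_ends_d st) eqxx.
have [u ua'] := perp_at da'.
have [y0 /andP[my0 py0] uy0] := mp'.2 a.
(* With [opp] present the perpendicular sides are absent, so the merged vertex is covered either
   from outside the tile or by the glued edge, of which [c] is the copy to keep. *)
case po: (p' opp).
  have pE y : y.1 != d.1 -> unglue_pred y = p' y.
    move=> /dN h; rewrite /unglue_pred h -/opp po orbF.
    by case: eqP => [->|].
  have [y1 [hy1 my1 py1 y01]] : exists y1,
      [/\ y1.1 != d.1, meets g y1 a, p' y1 & same_edge g' y0 y1].
    move: (my0); rewrite aE => /orP[h|].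
      exists y0; split=> //; first exact: iso_meets_tile h.
      by rewrite /same_edge connect0.
    rewrite iso_meets // => ey0.
    have y0d : y0 = d.
      have dp : (d == perp u) = false.
        by rewrite /perp; case: (d) => j [s t] /=; rewrite !xpair_eqE; case: s;
          rewrite andbF.
      have [//|y0u] : y0 = d \/ y0 = perp u.
        move: ey0 da' ua' dp; rewrite !endsE.
        by do 3![case/orP=> /eqP->]; rewrite ?eqxx //; [left|right|right|left].
      by move: py0; rewrite y0u perpE po.
    exists c; split=> //; first by rewrite p'cd -y0d.
    by rewrite y0d (step_same_edge st) !eqxx !orbT.
  exists y1; first by rewrite my1 pE.
  move=> z mz; have hz := iso_meets_tile a_far mz; rewrite pE // => pz.
  apply: edge_off => //; rewrite same_edge_sym in y01; apply: connect_trans y01 _.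
  by apply: uy0 => //; rewrite aE mz.
(* With [opp] absent, [perp u] already covers the merged vertex; a side of [p'] at [a] other than
   [c] would be a second covering edge. *)
have cNd : (c == d) = false by apply: contraNF cd => /eqP->.
exists c; first by rewrite mca /unglue_pred cNd eqxx -/opp po orbT.
move=> z mz; have hz := iso_meets_tile a_far mz.
rewrite /unglue_pred dN //; case: eqP => [->|/eqP zc pz].
  by rewrite /same_edge connect0.
exfalso.
have y0z : same_edge g' y0 z by apply: uy0 => //; rewrite aE mz.
have y0u : same_edge g' y0 (perp u).
  by apply: uy0; rewrite ?perpE ?po // aE (@iso_meets _ a') // ua' orbT.
rewrite same_edge_sym in y0u.
have : same_edge g' (perp u) z by apply: connect_trans y0u y0z.
rewrite (step_same_edge st) (dN z hz) (negbTE zc) !andbF !orbF.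
by move/(iso.2 (perp u) _ erefl) => e; move: hz; rewrite -e eqxx.
Qed.

End Unglue.

Lemma unglue_matching g g' c d a b a' b' p :
  glue_step g g' c d a b a' b' -> c.1 != d.1 -> isolated g d.1 ->
  is_matching g' p -> is_matching g (unglue_pred c d p).
Proof.
move=> st cd iso mp; split=> [y z hyz|x].
  have [->|yd] := eqVneq y z; first by [].
  have yNd : y != d.
    by apply: contraNneq yd => e; rewrite e; move: hyz;
      rewrite e (step_same_edge_d st) eq_sym.
  have yNc : y != c.
    by apply: contraNneq yd => e; rewrite e; move: hyz;
      rewrite e (step_same_edge_c st) eq_sym.
  have zNd : z != d.
    by apply: contraNneq yd => e; move: hyz;
      rewrite e same_edge_sym (step_same_edge_d st).
  have zNc : z != c.
    by apply: contraNneq yd => e; move: hyz;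
      rewrite e same_edge_sym (step_same_edge_c st).
  rewrite /unglue_pred (negbTE yNd) (negbTE yNc) (negbTE zNd) (negbTE zNc).
  by apply: mp.1; rewrite (step_same_edge st) hyz.
have [hx|hx] := eqVneq x.1 d.1.
  have tileE := unglue_tile st cd iso mp.
  move: (p _) tileE => o tileE.
  exists (if d.2.1 == o then vside x else hside x).
    rewrite (isolated_meets _ iso) // endsE /vside /hside hx.
    by case: ifP => h; rewrite tileE eqxx ?orbT /=; case: d.2.1 h; case: (o).
  move=> z; rewrite (isolated_meets _ iso) // endsE => /orP[]/eqP->;
    rewrite /vside /hside hx tileE; case: eqP; case: d.2.1; case: (o) => //;
    by rewrite /same_edge connect0.
case xa: (same_vertex g x a); first exact: (unglue_covered st).
case xb: (same_vertex g x b).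
  exact: (unglue_covered (glue_step_sym st)).
have farx v : ends d v -> ~~ same_vertex g x v.
  move=> /andP[/eqP hv _]; apply/negP; rewrite same_vertex_sym => /(iso.1 _ _ hv) e.
  by rewrite -e hv eqxx in hx.
have mE y : meets g' y x = meets g y x.
  apply: (step_meets_other st); rewrite ?xa ?xb //; apply: farx;
  by rewrite (step_ends_d st) eqxx ?orbT.
have [y /andP[my py] uy] := mp.2 x.
have pE z : meets g z x -> unglue_pred c d p z = p z.
  move=> mz; rewrite /unglue_pred; case: eqP => [e|_].
    by move: mz; rewrite e => /(isolated_meets_tile iso hx); rewrite eqxx.
  case: eqP => // e; move: mz; rewrite e (step_meets_c st) xa xb //.
rewrite mE in my; exists y; first by rewrite my pE.
move=> z mz; rewrite pE // => pz; have := uy z; rewrite mE => /(_ mz pz).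
rewrite (step_same_edge st) => /or3P[//|/andP[/eqP e _]|/andP[/eqP e _]].
  by move: my; rewrite e (step_meets_c st) xa xb.
by move: my; rewrite e => /(isolated_meets_tile iso hx); rewrite eqxx.
Qed.

End Ungluing.

(** * Patterns on the separate tiles *)

Section LocalPattern.
Variable n : nat.
Implicit Types (g : gluing n) (x : 'I_n * corner) (y z c d : 'I_n * side)
  (p : pred ('I_n * side)) (N : {set 'I_n}).

(* Tile [i], cut out of the graph, carries the pair of opposite sides that the
   lattice orientation makes maximal if [i \in N], and the minimal one otherwise. *)
Definition local N y : bool := (y.2.1 (+) odd y.1) (+) (y.1 \in N).

Definition compatible g N : Prop :=
  forall y z, side_glue g y z -> local N y || local N z.

Definition patched g N : pred ('I_n * side) :=
  fun y => [forall z, same_edge g y z ==> local N z].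

Lemma patched_same_edge g N y z : same_edge g y z -> patched g N y = patched g N z.
Proof.
move=> h; apply: eq_forallb => t.
by rewrite /same_edge (same_connect (@linked_connect_sym _ (side_glue g)) h).
Qed.

Lemma patched_alone g N y :
  (forall z, same_edge g y z -> z = y) -> patched g N y = local N y.
Proof.
move=> h; apply/forallP/idP => [/(_ y)|hy z]; first by rewrite /same_edge connect0.
by apply/implyP => /h->.
Qed.

Lemma eq_is_matching g p p' : p =1 p' -> is_matching g p -> is_matching g p'.
Proof.
move=> e [h1 h2]; split=> [y z|x]; first by rewrite -!e; apply: h1.
have [y] := h2 x; rewrite e => hy uy; exists y => // z; rewrite -e; exact: uy.
Qed.

(** A gluing conjoins the patterns on [c] and [d] whatever was glued before, so a single formula in
    [N] describes the outcome of all gluings. *)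
Lemma patched_step g g' c d a b a' b' N :
  glue_step g g' c d a b a' b' -> patched g' N =1 glue_pred c d (patched g N).
Proof.
move=> st y; rewrite /glue_pred.
have pc : patched g N c = local N c.
  by apply: patched_alone => z; rewrite (step_same_edge_c st) => /eqP.
have pd : patched g N d = local N d.
  by apply: patched_alone => z; rewrite (step_same_edge_d st) => /eqP.
have pc' : patched g' N c = local N c && local N d.
  apply/forallP/andP => [h|[h1 h2] z].
    split; first by have := h c; rewrite /same_edge connect0.
    by have := h d; rewrite (step_same_edge st) !eqxx orbT.
  rewrite (step_same_edge st) (step_same_edge_c st).
  by apply/implyP => /or3P[/eqP->|/andP[_ /eqP->]|/andP[_ /eqP->]].
case: eqP => [->|/eqP yc] /=; first by rewrite pc' pc pd.
case: eqP => [->|/eqP yd] /=.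
  rewrite pc pd -pc'; apply: patched_same_edge.
  by rewrite (step_same_edge st) !eqxx !orbT.
apply: eq_forallb => z; rewrite (step_same_edge st).
by rewrite (negbTE yc) (negbTE yd) /= !orbF.
Qed.

Lemma patched_step_matching g g' c d a b a' b' N :
  glue_step g g' c d a b a' b' -> local N c || local N d ->
  is_matching g (patched g N) -> is_matching g' (patched g' N).
Proof.
move=> st hcd hm; apply: eq_is_matching (glue_step_matching st hm _).
  by move=> y; rewrite (patched_step _ st).
have -> : patched g N c = local N c.
  by apply: patched_alone => z; rewrite (step_same_edge_c st) => /eqP.
rewrite (_ : patched g N d = local N d) //.
by apply: patched_alone => z; rewrite (step_same_edge_d st) => /eqP.
Qed.

Lemma discrete_patched_matching g N :
  (forall j, isolated g j) -> is_matching g (patched g N).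
Proof.
move=> iso; split=> [y z|x]; first exact: patched_same_edge.
have pE y : patched g N y = local N y.
  by apply: patched_alone => z /((iso y.1).2 y z erefl).
exists (if odd x.1 (+) (x.1 \in N) then hside x else vside x).
  rewrite (isolated_meets _ (iso x.1)) // endsE pE /local.
  by case: ifP => h; rewrite eqxx ?orbT //= ?addNb h.
move=> z; rewrite (isolated_meets _ (iso x.1)) // endsE pE /local.
case/orP=> /eqP->; rewrite /= ?addNb; first by move->; rewrite /same_edge connect0.
by move=> /negbTE->; rewrite /same_edge connect0.
Qed.

(** On a separate tile each horizontal side meets each vertical one in a corner, where exactly one
    of them is chosen; hence parallel sides agree and one bit describes the tile. *)
Lemma discrete_matching_local g p :
  (forall j, isolated g j) -> is_matching g p -> exists N, p =1 local N.
Proof.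
move=> iso [_ hp].
have key (j : 'I_n) u v : p (j, (false, v)) = ~~ p (j, (true, u)).
  have [y /andP[]] := hp (j, (u, v)).
  have mE t : meets g t (j, (u, v)) = (t == (j, (false, v))) || (t == (j,
    (true, u))).
    by rewrite (isolated_meets _ (iso j)) // endsE.
  move=> my py uy.
  have := uy (j, (false, v)); have := uy (j, (true, u)).
  rewrite !mE !eqxx orbT => /(_ isT) h1 /(_ isT) h2.
  move: my py h1 h2; rewrite mE => /orP[]/eqP->.
    by move=> -> h _; apply/esym/negP => /h /((iso j).2 (j, (false, v)) _ erefl).
  by move=> pu _ h; rewrite pu;
    apply/negbTE/negP => /h /((iso j).2 (j, (true, u)) _ erefl).
(* Obtained by solving [p = local N] for membership at the East side. *)
exists [set j | ~~ (p (j, (true, true)) (+) odd j)] => -[j [[] u]].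
  rewrite /local inE /= -[LHS]negbK -(key j u true) (key j true true).
  by case: (p _); case: odd.
by rewrite /local inE /= (key j true); case: (p _); case: odd.
Qed.

End LocalPattern.

(** * Snake graphs *)

Section Snake.
Variable w : seq letter.
Let n := (size w).+1.
Implicit Types (N : {set 'I_n}) (k m : nat).

(* The snake graph of the first [m.+1] tiles, next to the remaining tiles. *)
Definition snake_prefix m : gluing n :=
  Gluing (fun u v => snake_corners u v && (v.1 <= m))
         (fun u v => snake_sides u v && (v.1 <= m)).

Definition exit_side k : 'I_n * side := (inord k, if on_right w k then sE else sN).
Definition entry_side k : 'I_n * side :=
  (inord k.+1, if on_right w k then sW else sS).

(* The sum of the coordinates of a corner when the first tile is at the origin. *)
Definition level (x : 'I_n * corner) : nat := x.1 + x.2.1 + x.2.2.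

(** Passing to the next tile raises the index by one, while one coordinate of the corner drops from
    1 to 0. *)
Lemma snake_corners_level u v : snake_corners u v -> level u = level v.
Proof.
case: u v => [i [q1 q2]] [j [r1 r2]] /andP[/= /eqP ej]; rewrite /level /= ej.
by case: ifP => _; rewrite !inE => /orP[]/eqP[-> -> -> ->];
  rewrite ?addn0 ?addn1 ?addSn ?addnS ?addn0.
Qed.

Lemma inord_eq k (i : 'I_n) : k < n -> (i == inord k) = (i == k :> nat).
Proof. by move=> h; rewrite -val_eqE /= inordK. Qed.

Lemma snake_prefix_step k : k < size w -> simple_sides (snake_prefix k) ->
  glue_step (snake_prefix k) (snake_prefix k.+1) (exit_side k) (entry_side k)
    (inord k, cNE) (inord k, if on_right w k then cSE else cNW)
    (inord k.+1, if on_right w k then cNW else cSE) (inord k.+1, cSW).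
Proof.
move=> hk sk; have hk1 : k < n by apply: ltnW.
have hk2 : k.+1 < n by [].
split=> //.
- case=> [i q] [j r]; rewrite /= /snake_corners /= !xpair_eqE !inord_eq //.
  have [ej|ej] /= := eqVneq (j : nat) i.+1; last first.
    by apply/esym/negbTE;
      apply: contra ej => /orP[] /andP[/andP[/eqP-> _] /andP[/eqP->]].
  rewrite ej ltnS eqSS; case: (ltngtP i k) => [h|h|->] /=; rewrite ?andbF ?orbF //.
  by case: ifP => _; rewrite andbT !inE !xpair_eqE.
- case=> [i q] [j r]; rewrite /= /snake_sides /= !xpair_eqE !inord_eq //.
  have [ej|ej] /= := eqVneq (j : nat) i.+1; last first.
    by apply/esym/negbTE; apply: contra ej => /andP[/andP[/eqP-> _] /andP[/eqP->]].
  rewrite ej ltnS eqSS; case: (ltngtP i k) => [h|h|->] /=; rewrite ?andbF ?orbF //.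
  by case: ifP => _; rewrite xpair_eqE andbT.
- case=> [i [q1 q2]]; rewrite endsE /exit_side /hside /vside /= !xpair_eqE
    !(eq_sym (inord k)).
  by case: (i == _) => //=; case: ifP => _; case: q1 q2 => [] [].
- case=> [i [q1 q2]]; rewrite endsE /entry_side /hside /vside /= !xpair_eqE
    !(eq_sym (inord k.+1)).
  by case: (i == _) => //=; case: ifP => _; case: q1 q2 => [] [].
- case=> [j r]; rewrite /linked /= /snake_sides /= inordK //; apply/negP => /orP[].
    by case/andP=> /andP[/eqP-> _]; rewrite ltnn.
  by case/andP=> /andP[_]; do 2!case: ifP => _; rewrite xpair_eqE andbF.
- case=> [j r]; rewrite /linked /= /snake_sides /= inordK //; apply/negP => /orP[].
    by case/andP=> /andP[/eqP-> _]; rewrite ltnNge leqnSn.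
  by rewrite ltnn andbF.
(* [level] alone agrees on the two corners of each pair about to be glued. The tiles beyond [k],
   still separate, are therefore shifted by [n.+2], which exceeds every level, the largest being
   [n.+1]. *)
exists (fun x => level x + (k < x.1) * n.+2) => [u v|].
  case/andP=> h hv; rewrite (snake_corners_level h) !ltnNge hv.
  by case/andP: h => /eqP ev _; rewrite (leq_trans _ hv) // ev.
rewrite /level /= !inordK // !ltnn ltnSn !mul0n !mul1n !addn0 !addn1.
by case: ifP => _; rewrite /= !inE !negb_or ?addn0 ?addn1 !neq_ltn; lia.
Qed.

Lemma snake_prefix_simple k : k <= size w -> simple_sides (snake_prefix k).
Proof.
elim: k => [_ u v v'|k IH hk]; last first.
  by apply: glue_step_simple (snake_prefix_step hk (IH _)); apply: ltnW.
by rewrite /linked /= /snake_sides => /orP[]/andP[/andP[/eqP->]].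
Qed.

Lemma snake_prefix_isolated k (j : 'I_n) : k < j \/ k = 0 -> isolated
  (snake_prefix k) j.
Proof.
move=> hj; split=> -[i q] y /= ->; apply: connect_unlinked => z; apply/negP;
  (case/orP=> /andP[/andP[/= /eqP e _]]; [rewrite e|]);
  case: hj => [hj|->]; rewrite ?ltn0 //.
- by move/(ltn_trans hj); rewrite ltnn.
- by rewrite leqNgt hj.
- by rewrite e.
- by move/(ltn_trans hj); rewrite ltnn.
- by rewrite leqNgt hj.
by rewrite e.
Qed.

Lemma snake_prefix_patched m N : m <= size w ->
  compatible (snake_prefix m) N -> is_matching (snake_prefix m) (patched
    (snake_prefix m) N).
Proof.
elim: m => [_ _|m IH hm hN].
  by apply: discrete_patched_matching => j; apply: snake_prefix_isolated; right.
have st := snake_prefix_step hm (snake_prefix_simple (ltnW hm)).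
apply: (patched_step_matching st); first by apply: hN;
  rewrite (step_sides st) !eqxx orbT.
apply: IH; first exact: ltnW.
by move=> y z h; apply: hN; rewrite (step_sides st) h.
Qed.

(** The last tile attached is isolated in the shorter prefix, so it can be unglued. Tiles not yet
    attached remain in the graph as isolated tiles; hence the same [N] serves before and after the
    step. *)
Lemma snake_prefix_matching m p : m <= size w -> is_matching (snake_prefix m) p ->
  exists2 N, compatible (snake_prefix m) N & p =1 patched (snake_prefix m) N.
Proof.
elim: m p => [|m IH] p hm mp.
  have iso j : isolated (snake_prefix 0) j by apply: snake_prefix_isolated; right.
  have [N pN] := discrete_matching_local iso mp; exists N.
    by move=> y z /andP[/andP[/eqP->]].
  by move=> y; rewrite pN patched_alone // => z /((iso y.1).2 y z erefl).
have st := snake_prefix_step hm (snake_prefix_simple (ltnW hm)).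
have hm' : m < n by apply: ltnW.
have cd : (exit_side m).1 != (entry_side m).1.
  by rewrite /= inord_eq //= inordK // neq_ltn leqnn.
have iso : isolated (snake_prefix m) (entry_side m).1.
  by apply: snake_prefix_isolated; left; rewrite /= inordK.
have mq := unglue_matching st cd iso mp.
have [N hN qN] := IH _ (ltnW hm) mq.
have qc : unglue_pred (exit_side m) (entry_side m) p (exit_side m) = local N
  (exit_side m).
  by rewrite qN patched_alone // => z; rewrite (step_same_edge_c st) => /eqP.
have qd : unglue_pred (exit_side m) (entry_side m) p (entry_side m) = local N
  (entry_side m).
  by rewrite qN patched_alone // => z; rewrite (step_same_edge_d st) => /eqP.
exists N.
  move=> y z; rewrite (step_sides st) => /orP[/hN //|/andP[/eqP-> /eqP->]].
  by rewrite -qc -qd unglue_pred_or.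
move=> y; rewrite (glue_unglue_pred st cd iso mp) (patched_step _ st).
by rewrite /glue_pred !qN.
Qed.

End Snake.

Lemma eq_gluing_matching (n : nat) (g g' : gluing n) :
  corner_glue g =2 corner_glue g' -> side_glue g =2 side_glue g' ->
  [/\ same_edge g =2 same_edge g', same_vertex g =2 same_vertex g'
    & forall p, is_matching g p -> is_matching g' p].
Proof.
move=> ec es.
have ee : same_edge g =2 same_edge g' by apply: eq_connect => y z;
  rewrite /linked !es.
have ev : same_vertex g =2 same_vertex g' by apply: eq_connect => y z;
  rewrite /linked !ec.
have em : meets g =2 meets g' by move=> y x; apply: eq_existsb => u; rewrite ev.
split=> // p [h1 h2]; split=> [y z|x]; first by rewrite -ee; apply: h1.
have [y hy uy] := h2 x; exists y; first by rewrite -em.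
by move=> z; rewrite -em -ee; apply: uy.
Qed.

Lemma snake_matchingP (w : seq letter) p :
  is_matching (snake_graph w) p <->
  exists2 N, compatible (snake_graph w) N & p =1 patched (snake_graph w) N.
Proof.
have e1 : corner_glue (snake_prefix w (size w)) =2 corner_glue (snake_graph w).
  by move=> u v; rewrite /= -ltnS ltn_ord andbT.
have e2 : side_glue (snake_prefix w (size w)) =2 side_glue (snake_graph w).
  by move=> u v; rewrite /= -ltnS ltn_ord andbT.
have e1' : corner_glue (snake_graph w) =2 corner_glue (snake_prefix w (size w))
  by [].
have e2' : side_glue (snake_graph w) =2 side_glue (snake_prefix w (size w)) by [].
have [ee _ em] := eq_gluing_matching e1 e2.
have [_ _ em'] := eq_gluing_matching e1' e2'.
have ep N : patched (snake_prefix w (size w)) N =1 patched (snake_graph w) N.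
  by move=> y; apply: eq_forallb => z; rewrite ee.
have ec N : compatible (snake_prefix w (size w)) N <-> compatible (snake_graph w) N.
  by split=> h y z; rewrite -?e2 ?e2 => hyz; apply: h; rewrite ?e2.
split=> [/em'/(snake_prefix_matching (leqnn _))[N /ec hN pN]|[N /ec hN pN]].
  by exists N => // y; rewrite pN ep.
apply: em; apply: eq_is_matching (snake_prefix_patched (leqnn _) hN) => y.
by rewrite pN ep.
Qed.

(** * Loops *)

Section Loops.
Variable w : seq letter.
Hypothesis hw : is_loopword w.
Let n := (size w).+1.
Implicit Types (N : {set 'I_n}) (k : nat).

Lemma loop_bounds k : is_loop (letter_at w k) -> 0 < k /\ k.+1 < size w.
Proof.
case/and4P: hw => _ hh hl _ hk.
have ks : k < size w.
  (* Out of range [letter_at] returns [Dir], which is not a loop. *)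
  by rewrite ltnNge; apply: contraL hk => h; rewrite /letter_at nth_default.
split.
  by rewrite lt0n; apply: contraL hk => /eqP->; rewrite /letter_at nth0.
rewrite ltn_neqAle ks andbT; apply: contraL hk => /eqP e.
by rewrite /letter_at -[k]/k.+1.-1 e nth_last.
Qed.

Lemma right_loop_opposite k i : right_loop w k -> k < i -> i < size w ->
  opposite_arrow (letter_at w k) (letter_at w i).
Proof.
case/andP=> _ /(all_nthP Dir) ha ki hi.
have := ha (i - k.+1); rewrite size_drop nth_drop subnKC //; apply.
by rewrite ltn_sub2r // (leq_ltn_trans ki).
Qed.

Lemma left_loop_opposite k i : left_loop w k -> k < size w -> i < k ->
  opposite_arrow (letter_at w k) (letter_at w i).
Proof.
case/andP=> _ /(all_nthP Dir) ha hk ik.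
by have := ha i; rewrite size_take hk nth_take //; apply.
Qed.

Lemma opposite_arrow_direct l l' : opposite_arrow l l' -> is_direct l' = ~~
  is_direct l.
Proof. by case: l l' => [] []. Qed.

Lemma opposite_arrow_loop l l' : opposite_arrow l l' -> is_loop l' = false.
Proof. by case: l l' => [] []. Qed.

(** Of two right loops, the earlier would force the later to be an ordinary arrow. *)
Lemma right_loop_unique k k' : k < size w -> k' < size w ->
  right_loop w k -> right_loop w k' -> k = k'.
Proof.
move=> hk hk' rk rk'; case: (ltngtP k k') => // h.
  by have := opposite_arrow_loop (right_loop_opposite rk h hk');
    case/andP: rk' => ->.
by have := opposite_arrow_loop (right_loop_opposite rk' h hk); case/andP: rk => ->.
Qed.

Lemma left_loop_unique k k' : k < size w -> k' < size w ->
  left_loop w k -> left_loop w k' -> k = k'.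
Proof.
move=> hk hk' rk rk'; case: (ltngtP k k') => // h.
  by have := opposite_arrow_loop (left_loop_opposite rk' hk' h); case/andP: rk => ->.
by have := opposite_arrow_loop (left_loop_opposite rk hk h); case/andP: rk' => ->.
Qed.

Definition right_corners : rel ('I_n * corner) := fun x y =>
  [exists k : 'I_(size w), [&& right_loop w k, x.1 == size w :> nat,
     y.1 == k :> nat & (x.2, y.2) \in right_loop_corners w k]].
Definition right_sides : rel ('I_n * side) := fun x y =>
  [exists k : 'I_(size w), [&& right_loop w k, x.1 == size w :> nat,
     y.1 == k :> nat & (x.2, y.2) == right_loop_sides w k]].
Definition left_corners : rel ('I_n * corner) := fun x y =>
  [exists k : 'I_(size w), [&& left_loop w k, x.1 == 0 :> nat,
     y.1 == k.+1 :> nat & (x.2, y.2) \in left_loop_corners w k]].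
Definition left_sides : rel ('I_n * side) := fun x y =>
  [exists k : 'I_(size w), [&& left_loop w k, x.1 == 0 :> nat,
     y.1 == k.+1 :> nat & (x.2, y.2) == left_loop_sides w k]].

Lemma loop_cornersE x y : loop_corners x y = right_corners x y || left_corners x y.
Proof.
apply/existsP/orP => [[k /orP[h|h]]|[]/existsP[k h]].
- by left; apply/existsP; exists k.
- by right; apply/existsP; exists k.
- by exists k; rewrite h.
by exists k; rewrite h orbT.
Qed.

Lemma loop_sidesE x y : loop_sides x y = right_sides x y || left_sides x y.
Proof.
apply/existsP/orP => [[k /orP[h|h]]|[]/existsP[k h]].
- by left; apply/existsP; exists k.
- by right; apply/existsP; exists k.
- by exists k; rewrite h.
by exists k; rewrite h orbT.
Qed.

(** An intermediate stage: a word with two loops is reached from its snake graph by two single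
    gluings. *)
Definition right_graph : gluing n :=
  Gluing (fun x y => snake_corners x y || right_corners x y)
         (fun x y => snake_sides x y || right_sides x y).

(** Snake gluings join a North or East side to a South or West one, right loops join two sides of
    the first kind, left loops two of the second. These types settle most cases when a side is to be
    shown free. *)
Lemma snake_sides_dir (x y : 'I_n * side) :
  snake_sides x y -> x.2.2 = true /\ y.2.2 = false.
Proof. by case/andP=> _; case: ifP => _ /eqP[-> ->]. Qed.

Lemma right_sides_dir x y : right_sides x y -> x.2.2 = true /\ y.2.2 = true.
Proof.
by case/existsP=> k /and4P[_ _ _ /eqP[-> ->]]; split; case: ifP.
Qed.

Lemma left_sides_dir x y : left_sides x y -> x.2.2 = false /\ y.2.2 = false.
Proof.
by case/existsP=> k /and4P[_ _ _ /eqP[-> ->]]; split; case: ifP.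
Qed.

Lemma snake_simple : simple_sides (snake_graph w).
Proof.
have h := @snake_prefix_simple w (size w) (leqnn _).
have e u v : linked (side_glue (snake_graph w)) u v =
    linked (side_glue (snake_prefix w (size w))) u v.
  by rewrite /linked /= -(ltnS u.1) -(ltnS v.1) !ltn_ord !andbT.
by move=> u v v'; rewrite !e; apply: h.
Qed.

Lemma right_step (k : 'I_(size w)) : right_loop w k ->
  glue_step (snake_graph w) right_graph
    (ord_max, (right_loop_sides w k).1) (inord k, (right_loop_sides w k).2)
    (ord_max, cNE) (ord_max, if on_right w (size w).-1 then cSE else cNW)
    (inord k, if on_right w k then cNW else cSE) (inord k, cNE).
Proof.
move=> rk; have hk := ltn_ord k; have kn : k < n by apply: ltnW.
have [k0 ks] := loop_bounds (proj1 (andP rk)).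
have uk (k' : 'I_(size w)) : right_loop w k' -> k' = k.
  by move=> rk'; apply: val_inj (right_loop_unique (ltn_ord k') hk rk' rk).
split.
- move=> [i q] [j r]; rewrite /= !xpair_eqE !inord_eq // -!val_eqE /=.
  congr orb; apply/existsP/idP => [[k']|h].
    move=> /and4P[/uk-> /= hi hj]; rewrite hi hj !inE !xpair_eqE /=.
    by case/orP=> /andP[-> ->]; rewrite ?orbT.
  exists k; rewrite rk /= !inE !xpair_eqE.
  by case/orP: h => /andP[/andP[-> ->] /andP[-> ->]]; rewrite ?orbT.
- move=> [i q] [j r]; rewrite /= !xpair_eqE !inord_eq // -!val_eqE /=.
  congr orb; apply/existsP/idP => [[k']|h].
    by move=> /and4P[/uk-> /= hi hj /eqP[-> ->]]; rewrite hi hj !eqxx.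
  exists k; rewrite rk /=.
  by case/andP: h => /andP[-> /eqP->] /andP[-> /eqP->]; apply/eqP.
- case=> [i [q1 q2]]; rewrite endsE /hside /vside /= !xpair_eqE !(eq_sym ord_max).
  by case: (i == _) => //=; case: ifP => _; case: q1 q2 => [] [].
- case=> [i [q1 q2]]; rewrite endsE /hside /vside /= !xpair_eqE !(eq_sym (inord k)).
  by case: (i == _) => //=; case: ifP => _; case: q1 q2 => [] [].
- move=> [j r]; apply/negP => /orP[].
    by case/andP=> /= /eqP e _; have := ltn_ord j; rewrite e ltnn.
  by case/snake_sides_dir => _ /=; case: ifP.
- move=> [j r]; apply/negP => /orP[].
    by case/andP=> /=; rewrite inordK // => _; case: ifP => _; rewrite xpair_eqE.
  by case/snake_sides_dir => _ /=; case: ifP.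
- exact: snake_simple.
(* The levels are [size w + 2], [size w + 1], [k + 1] and [k + 2]; they differ because a loop is not
   the last letter, so that [k + 1 < size w]. *)
exists (@level w); first exact: snake_corners_level.
rewrite /level /= !inordK //.
by case: ifP => _; case: ifP => _;
  rewrite /= !inE !negb_or ?addn0 ?addn1 !neq_ltn; lia.
Qed.

Lemma right_graph0 : (forall k : 'I_(size w), ~~ right_loop w k) ->
  corner_glue (snake_graph w) =2 corner_glue right_graph /\
  side_glue (snake_graph w) =2 side_glue right_graph.
Proof.
move=> nr; split=> x y /=.
  by rewrite [right_corners _ _](negbTE _) ?orbF //; apply/existsPn => k;
    rewrite (negbTE (nr k)).
by rewrite [right_sides _ _](negbTE _) ?orbF //; apply/existsPn => k;
  rewrite (negbTE (nr k)).
Qed.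

Lemma right_simple : simple_sides right_graph.
Proof.
case: (pickP (fun k : 'I_(size w) => right_loop w k)) => [k /right_step|h].
  exact: glue_step_simple.
have [_ es] : corner_glue (snake_graph w) =2 corner_glue right_graph /\
  side_glue (snake_graph w) =2 side_glue right_graph.
  by apply: right_graph0 => k; rewrite h.
move=> u v v'; rewrite /linked -!es; exact: snake_simple.
Qed.

(* [level], corrected at the two corners of the last tile that a right loop at [k]
   glues to the tile [k]. *)
Definition right_level k (x : 'I_n * corner) : nat :=
  if level x == (size w).+2 then k.+1
  else if level x == (size w).+1 then k.+2 else level x.

Lemma right_level_small k x : level x <= size w -> right_level k x = level x.
Proof. by move=> h; rewrite /right_level !ltn_eqF // ltnW. Qed.

Lemma right_corners_level (k : 'I_(size w)) u v : right_loop w k ->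
  corner_glue right_graph u v -> right_level k u = right_level k v.
Proof.
move=> rk /orP[/snake_corners_level e|/existsP[k' /and4P[rk']]].
  by rewrite /right_level e.
have -> : k' = k.
  exact: val_inj (right_loop_unique (ltn_ord k') (ltn_ord k) rk' rk).
have [_ ks] := loop_bounds (proj1 (andP rk)).
case: u v => [i q] [j r] /= /eqP ei /eqP ej; rewrite !inE => /orP[]/eqP[-> ->].
  have -> : right_level k (i, cNE) = k.+1.
    by rewrite /right_level /level /= ei !addn1 eqxx.
  by case: ifP => _; rewrite right_level_small /level /= ?ej ?addn1 ?addn0 // ltnW.
have lv : level (i, if on_right w (size w).-1 then cSE else cNW) = (size w).+1.
  by rewrite /level; case: ifP => _ /=; rewrite ei ?addn0 ?addn1.
rewrite /right_level lv ltn_eqF // eqxx -/(right_level k _).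
by rewrite right_level_small /level /= ej !addn1.
Qed.

Lemma left_step (k : 'I_(size w)) : left_loop w k ->
  glue_step right_graph (loop_graph w)
    (ord0, (left_loop_sides w k).1) (inord k.+1, (left_loop_sides w k).2)
    (ord0, cSW) (ord0, if on_right w 0 then cNW else cSE)
    (inord k.+1, if on_right w k then cSE else cNW) (inord k.+1, cSW).
Proof.
move=> lk; have hk := ltn_ord k; have kn : k.+1 < n by [].
have [k0 ks] := loop_bounds (proj1 (andP lk)).
have uk (k' : 'I_(size w)) : left_loop w k' -> k' = k.
  by move=> lk'; apply: val_inj (left_loop_unique (ltn_ord k') hk lk' lk).
split.
- move=> [i q] [j r]; rewrite /= !xpair_eqE !inord_eq // -!val_eqE /=.
  rewrite loop_cornersE orbA; congr orb; apply/existsP/idP => [[k']|h].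
    move=> /and4P[/uk-> /= hi hj]; rewrite hi hj !inE !xpair_eqE /=.
    by case/orP=> /andP[-> ->]; rewrite ?orbT.
  exists k; rewrite lk /= !inE !xpair_eqE.
  by case/orP: h => /andP[/andP[-> ->] /andP[-> ->]]; rewrite ?orbT.
- move=> [i q] [j r]; rewrite /= !xpair_eqE !inord_eq // -!val_eqE /=.
  rewrite loop_sidesE orbA; congr orb; apply/existsP/idP => [[k']|h].
    by move=> /and4P[/uk-> /= hi hj /eqP[-> ->]]; rewrite hi hj !eqxx.
  exists k; rewrite lk /=.
  by case/andP: h => /andP[-> /eqP->] /andP[-> /eqP->]; apply/eqP.
- case=> [i [q1 q2]]; rewrite endsE /hside /vside /= !xpair_eqE !(eq_sym ord0).
  by case: (i == _) => //=; case: ifP => _; case: q1 q2 => [] [].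
- case=> [i [q1 q2]]; rewrite endsE /hside /vside /= !xpair_eqE !(eq_sym (inord
    k.+1)).
  by case: (i == _) => //=; case: ifP => _; case: q1 q2 => [] [].
- move=> z; apply/negP => /orP[]/orP[].
  + by case/snake_sides_dir => /=; case: ifP.
  + by case/right_sides_dir => /=; case: ifP.
  + by case/andP.
  by case/right_sides_dir => _ /=; case: ifP.
- move=> [j r]; apply/negP => /orP[]/orP[].
  + by case/snake_sides_dir => /=; case: ifP.
  + by case/right_sides_dir => /=; case: ifP.
  + by case/andP=> /=; rewrite inordK // eqSS => /eqP <-; case: ifP => _;
      rewrite xpair_eqE andbF.
  by case/right_sides_dir => _ /=; case: ifP.
- exact: right_simple.
have la : @level w (inord k.+1, if on_right w k then cSE else cNW) = k.+2.
  by rewrite /level; case: ifP => _; rewrite /= inordK // ?addn0 ?addn1.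
have lb : @level w (inord k.+1, cSW) = k.+1 by rewrite /level /= inordK ?addn0.
have l0 : @level w (ord0, if on_right w 0 then cNW else cSE) = 1.
  by rewrite /level; case: ifP.
have lev : uniq [:: @level w (ord0, cSW);
  @level w (ord0, if on_right w 0 then cNW else cSE);
    @level w (inord k.+1, if on_right w k then cSE else cNW);
      @level w (inord k.+1, cSW)].
  by rewrite la lb l0 /level /= !inE !eqSS; lia.
(* The four levels 0, 1, [k + 2] and [k + 1] are at most [size w], so the correction that a right
   loop requires does not affect them. *)
case: (pickP (fun k' : 'I_(size w) => right_loop w k')) => [k' rk'|h].
  exists (right_level k') => [u v|]; first exact: right_corners_level.
  by rewrite !right_level_small //; rewrite ?la ?lb ?l0; lia.
have [ec _] : corner_glue (snake_graph w) =2 corner_glue right_graph /\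
  side_glue (snake_graph w) =2 side_glue right_graph.
  by apply: right_graph0 => k'; rewrite h.
by exists (@level w) => [u v|//]; rewrite -ec; apply: snake_corners_level.
Qed.

End Loops.

(** * Good matchings *)

Section GoodMatchings.
Variable w : seq letter.
Hypothesis hw : is_loopword w.
Let n := (size w).+1.
Let lg := loop_graph w.
Let sg := snake_graph w.
Implicit Types (N : {set 'I_n}) (x y z : 'I_n * side) (P : {set {set 'I_n * side}}).

Lemma eq_gluing_patched (g g' : gluing n) N :
  corner_glue g =2 corner_glue g' -> side_glue g =2 side_glue g' ->
  is_matching g (patched g N) -> is_matching g' (patched g' N).
Proof.
move=> ec es; have [ee _ em] := eq_gluing_matching ec es; move/em.
by apply: eq_is_matching => y; apply: eq_forallb => z; rewrite ee.
Qed.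

Lemma left_graph0 : (forall k : 'I_(size w), ~~ left_loop w k) ->
  corner_glue (right_graph w) =2 corner_glue lg /\
  side_glue (right_graph w) =2 side_glue lg.
Proof.
move=> nr; split=> x y /=; rewrite ?loop_cornersE ?loop_sidesE orbA.
  by rewrite [left_corners _ _](negbTE _) ?orbF //; apply/existsPn => k;
    rewrite (negbTE (nr k)).
by rewrite [left_sides _ _](negbTE _) ?orbF //; apply/existsPn => k;
  rewrite (negbTE (nr k)).
Qed.

Lemma loop_simple : simple_sides lg.
Proof.
case: (pickP (fun k : 'I_(size w) => left_loop w k)) => [k /(left_step hw)|h].
  exact: glue_step_simple.
have [_ es] : corner_glue (right_graph w) =2 corner_glue lg /\
  side_glue (right_graph w) =2 side_glue lg.
  by apply: left_graph0 => k; rewrite h.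
move=> u v v'; rewrite /linked -!es; exact: right_simple.
Qed.

Lemma loop_patched_matching N : compatible lg N -> is_matching lg (patched lg N).
Proof.
move=> hN.
have ms : is_matching sg (patched sg N).
  apply/snake_matchingP; exists N => // y z h; apply: hN.
  by rewrite /= [snake_sides _ _]h.
have mr : is_matching (right_graph w) (patched (right_graph w) N).
  case: (pickP (fun k : 'I_(size w) => right_loop w k)) => [k rk|h].
    have st := right_step hw rk; apply: (patched_step_matching st) ms; apply: hN.
    by have := step_sides st; rewrite /= loop_sidesE orbA => ->; rewrite !eqxx orbT.
  have [ec es] : corner_glue sg =2 corner_glue (right_graph w) /\
      side_glue sg =2 side_glue (right_graph w).
    by apply: right_graph0 => k; rewrite h.
  exact: eq_gluing_patched ms.
case: (pickP (fun k : 'I_(size w) => left_loop w k)) => [k lk|h].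
  have st := left_step hw lk; apply: (patched_step_matching st) mr; apply: hN.
  by rewrite (step_sides st) !eqxx orbT.
have [ec es] : corner_glue (right_graph w) =2 corner_glue lg /\
    side_glue (right_graph w) =2 side_glue lg.
  by apply: left_graph0 => k; rewrite h.
exact: eq_gluing_patched mr.
Qed.

Lemma loop_sides_free y z : loop_sides y z ->
  (forall t, ~~ linked (snake_sides (w := w)) y t) /\
  (forall t, ~~ linked (snake_sides (w := w)) z t).
Proof.
rewrite loop_sidesE => /orP[]/existsP[k /and4P[lk]].
  have st := right_step hw lk;
    case: y z => [i q] [j r] /= /eqP hi /eqP hj /eqP[-> ->].
  have -> : i = ord_max by apply: val_inj.
  have -> : j = inord k by apply: val_inj; rewrite /= inordK // ltnS ltnW.
  by split=> t; [exact: (step_free_c st t)|exact: (step_free_d st t)].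
have st := left_step hw lk; case: y z => [i q] [j r] /= /eqP hi /eqP hj /eqP[-> ->].
have -> : i = ord0 by apply: val_inj.
have -> : j = inord k.+1 by apply: val_inj; rewrite /= inordK ?ltnS.
split=> t.
  by apply: contra (step_free_c st t) => /orP[] h; apply/orP; [left|right];
    apply/orP; left.
by apply: contra (step_free_d st t) => /orP[] h; apply/orP; [left|right];
  apply/orP; left.
Qed.

Lemma patchedE (g : gluing n) N y : simple_sides g ->
  patched g N y =
  local N y && [forall z, linked (side_glue g) y z ==> local N z].
Proof.
move=> sg'; apply/forallP/andP => [h|[h1 /forallP h2] z].
  split; first by have := h y; rewrite /same_edge connect0.
  by apply/forallP => z; have := h z; rewrite (same_edgeE _ _ sg'); case: linked;
    rewrite ?orbT.
by rewrite (same_edgeE _ _ sg'); case: eqP => [<-|_] //=; rewrite h1.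
Qed.

Lemma patched_unlooped N y :
  ~~ [exists z, loop_sides y z || loop_sides z y] ->
  patched lg N y = patched sg N y.
Proof.
move/existsPn => h; rewrite (patchedE _ _ loop_simple) (patchedE _ _
  (@snake_simple w)).
congr andb; apply: eq_forallb => z; congr implb; have := h z.
by rewrite negb_or /linked /= => /andP[/negbTE-> /negbTE->]; rewrite !orbF.
Qed.

(** A looped side lies on the boundary of the snake graph and shows its raw pattern there; in the
    loop graph its edge consists of the two copies only. *)
Lemma patched_looped N y z : loop_sides y z ->
  [/\ patched sg N y = local N y, patched sg N z = local N z,
      patched lg N y = local N y && local N z
    & patched lg N z = local N y && local N z].
Proof.
move=> hyz; have [fy fz] := loop_sides_free hyz.
have lyz : linked (side_glue lg) y z by rewrite /linked /= hyz orbT.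
have lzy : linked (side_glue lg) z y by rewrite /linked /= hyz !orbT.
have fr t : (forall t', ~~ linked (side_glue sg) t t') -> patched sg N t = local N t.
  by move=> ft; apply: patched_alone => t' /(connect_unlinked ft).
rewrite !fr // !(patchedE _ _ loop_simple); split=> //.
  congr andb; apply/forallP/idP => [/(_ z)|hz t]; first by rewrite lyz.
  by apply/implyP => /(loop_simple lyz) <-.
rewrite andbC; congr andb; apply/forallP/idP => [/(_ y)|hz t]; first by rewrite lzy.
by apply/implyP => /(loop_simple lzy) <-.
Qed.

Definition loop_matching N := edge_set lg (patched lg N).

Lemma mem_loop_matching N y : (edge_of lg y \in loop_matching N) = patched lg N y.
Proof. by apply: mem_edge_set => u v; apply: patched_same_edge. Qed.

Lemma edge_set_matching (g : gluing n) N :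
  is_matching g (patched g N) -> perfect_matching g (edge_set g (patched g N)).
Proof.
move=> h; apply/perfect_matchingP; split; first exact: edge_set_sub.
apply: eq_is_matching h => y; rewrite mem_edge_set // => u v.
exact: patched_same_edge.
Qed.

(** [N] is the set belonging to the snake matching behind [P]. That one of the two copies of a glued
    edge is kept in [cut_open] is precisely compatibility at the loop; the other clauses recover [P]
    from [N]. *)
Lemma good_matchingP P :
  good_matching w P <-> exists2 N, compatible lg N & P = loop_matching N.
Proof.
split=> [/andP[/perfect_matchingP[sP mP] /existsP[P'
  /andP[/perfect_matchingP[sP' mP'] hcut]]]|].
  have /snake_matchingP[N hN pN] := mP'.
  case/andP: hcut => /forallP h1 /forallP h2.
  have cN : compatible lg N.
    move=> y z /orP[/hN //|hyz]; have [ey ez _ _] := patched_looped N hyz.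
    by have /implyP/(_ hyz) := forallP (h2 y) z; rewrite /= !pN ey ez => /andP[].
  exists N => //; rewrite -(edge_setK sP); apply: eq_edge_set => y.
  have [/existsP[z /orP[hyz|hzy]]|hy] := boolP [exists z, loop_sides y z ||
    loop_sides z y].
  - have [ey ez eyl _] := patched_looped N hyz.
    have /implyP/(_ hyz) := forallP (h2 y) z.
    by rewrite /= !pN ey ez => /andP[_ /eqP <-].
  - have [ey ez eyl ezl] := patched_looped N hzy.
    have /implyP/(_ hzy) := forallP (h2 z) y; rewrite /= !pN ey ez => /andP[_ /eqP].
    rewrite ezl => ->; apply: mP.1; rewrite same_edgeE; last exact: loop_simple.
    by rewrite /linked /= hzy !orbT.
  by have := implyP (h1 y) hy; rewrite pN -(patched_unlooped N hy) => /eqP <-.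
case=> N hN ->; have mN := loop_patched_matching hN.
have msN : is_matching sg (patched sg N).
  apply/snake_matchingP; exists N => // y z h; apply: hN.
  by rewrite /= [snake_sides _ _]h.
rewrite /good_matching edge_set_matching //; apply/existsP.
exists (edge_set sg (patched sg N)); rewrite edge_set_matching //=.
have sgE y : (edge_of sg y \in edge_set sg (patched sg N)) = patched sg N y.
  by apply: mem_edge_set => u v; apply: patched_same_edge.
apply/andP; split.
  apply/forallP => y; apply/implyP => hy.
  by rewrite sgE mem_loop_matching (patched_unlooped N hy).
apply/forallP => y; apply/forallP => z; apply/implyP => hyz.
rewrite /= !sgE mem_loop_matching; have [-> -> -> _] := patched_looped N hyz.
by rewrite eqxx andbT; apply: hN; rewrite /= hyz orbT.
Qed.

End GoodMatchings.

(** * Twists *)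

Section Twists.
Variable w : seq letter.
Hypothesis hw : is_loopword w.
Let n := (size w).+1.
Let lg := loop_graph w.
Implicit Types (N : {set 'I_n}) (x y z : 'I_n * side) (i j : 'I_n).

Lemma linked_tiles y z : linked (side_glue lg) y z -> y.1 != z.1.
Proof.
have h u v : side_glue lg u v -> u.1 != v.1.
  rewrite /= loop_sidesE => /or3P[/andP[/eqP e _]||].
  - by rewrite -val_eqE /= e neq_ltn leqnn.
  - by case/existsP=> k /and4P[_ /eqP e1 /eqP e2 _];
      rewrite -val_eqE /= e1 e2 gtn_eqF.
  by case/existsP=> k /and4P[_ /eqP e1 /eqP e2 _]; rewrite -val_eqE /= e1 e2.
by case/orP=> /h //; rewrite eq_sym.
Qed.

(** The previous tile is attached at South or West, left loops use only such sides, and a right loop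
    takes the other one of North and East. *)
Lemma last_side_free z :
  ~~ linked (side_glue lg) (ord_max, if on_right w (size w).-1 then sN else sE) z.
Proof.
apply/negP; rewrite /linked /= !loop_sidesE => /orP[]/or3P[].
- by case/andP=> /= /eqP e _; have := ltn_ord z.1; rewrite e ltnn.
- by case/existsP=> k /and4P[_ _ _]; rewrite /right_loop_sides xpair_eqE /=;
    case: on_right.
- by case/left_sides_dir => /=; case: on_right.
- by case/snake_sides_dir => _ /=; case: on_right.
- by case/existsP=> k /and4P[_ _ /= /eqP e _]; have := ltn_ord k; rewrite -e ltnn.
by case/left_sides_dir => _ /=; case: on_right.
Qed.

Lemma exit_entry_glued k : k < size w -> side_glue lg (exit_side w k)
  (entry_side w k).
Proof.
move=> hk; apply/orP; left; rewrite /snake_sides /= !inordK ?ltnS // ?eqxx;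
  last exact: ltnW.
by case: on_right.
Qed.

Lemma local_toggle N1 N2 y :
  local N1 y (+) local N2 y = (y.1 \in N1) (+) (y.1 \in N2).
Proof. by rewrite /local; case: (_ (+) odd _) (_ \in _) (_ \in _) => [] [] []. Qed.

(** Compatibility rules out that both patterns are false, and then conjunction is the negated sum
    modulo 2. Differences of two matchings thereby become additive in the patterns. *)
Lemma patched_linked N y z : compatible lg N -> linked (side_glue lg) y z ->
  patched lg N y = ~~ (local N y (+) local N z).
Proof.
move=> hN hyz; rewrite (patchedE _ _ (loop_simple hw)).
have -> : [forall t, linked (side_glue lg) y t ==> local N t] = local N z.
  apply/forallP/idP => [/(_ z)|hz t]; first by rewrite hyz.
  by apply/implyP => /(loop_simple hw hyz) <-.
have : local N y || local N z by case/orP: hyz => /hN //; rewrite orbC.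
by case: (local N y); case: (local N z).
Qed.

Lemma patched_free N y : (forall z, ~~ linked (side_glue lg) y z) ->
  patched lg N y = local N y.
Proof. by move=> h; apply: patched_alone => z /(connect_unlinked h). Qed.

(* The sides interior to the snake propagate the difference of [N1] and [N2] from
   the last tile, which has a side that is not glued at all. *)
Lemma toggled_tiles N1 N2 (K : pred 'I_n) :
  compatible lg N1 -> compatible lg N2 ->
  (forall y z, linked (side_glue lg) y z ->
     patched lg N1 y (+) patched lg N2 y = K y.1 (+) K z.1) ->
  (forall y, (forall z, ~~ linked (side_glue lg) y z) ->
     patched lg N1 y (+) patched lg N2 y = K y.1) ->
  forall j, (j \in N1) (+) (j \in N2) = K j.
Proof.
move=> h1 h2 hl hf j.
suff key m : m <= size w -> let i : 'I_n := inord (size w - m) in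
    (i \in N1) (+) (i \in N2) = K i.
  have := key (size w - j) (leq_subr _ _); rewrite subKn ?inord_val //.
  by rewrite -ltnS ltn_ord.
elim: m => [_|m IH hm].
  have := hf _ last_side_free;
    rewrite !(patched_free _ last_side_free) local_toggle /=.
  suff -> : inord (size w - 0) = ord_max :> 'I_n by [].
  by apply: val_inj; rewrite /= subn0 inordK.
set k := size w - m.+1 => i.
have ek : size w - m = k.+1 by rewrite /k; lia.
have lk : linked (side_glue lg) (exit_side w k) (entry_side w k).
  by rewrite /linked exit_entry_glued // /k; lia.
have := hl _ _ lk; rewrite !(patched_linked _ lk) //.
have := IH (ltnW hm); rewrite ek /= => <-; rewrite -/i.
have := local_toggle N1 N2 (exit_side w k);
  have := local_toggle N1 N2 (entry_side w k).
rewrite /= -/i; do 4 case: (local _ _) => /=;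
  by case: (i \in N1); case: (i \in N2); case: (K i); case: (_ \in N1);
    case: (_ \in N2).
Qed.

Lemma loop_matching_inj N1 N2 : compatible lg N1 -> compatible lg N2 ->
  loop_matching N1 = loop_matching N2 -> N1 = N2.
Proof.
move=> h1 h2 e; apply/setP => j.
have pE y : patched lg N1 y = patched lg N2 y by rewrite -!mem_loop_matching // e.
have : (j \in N1) (+) (j \in N2) = pred0 j.
  by apply: toggled_tiles => // y *; rewrite pE addbb.
by case: (j \in N1); case: (j \in N2).
Qed.

Definition pair_of (b : bool) i := if b then EW_pair lg i else NS_pair lg i.

Lemma same_edge_tile i (s t : side) : same_edge lg (i, s) (i, t) = (s == t).
Proof.
rewrite (same_edgeE _ _ (loop_simple hw)) xpair_eqE eqxx /=.
by case: linked (@linked_tiles (i, s) (i, t)) => [/(_ isT)|]; rewrite ?orbF ?eqxx.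
Qed.

Lemma mem_pair_of b i (s : side) : (edge_of lg (i, s) \in pair_of b i) = (s.1 == b).
Proof.
rewrite /pair_of; case: b; rewrite !inE !edge_of_eq !same_edge_tile;
by case: s => [[] []].
Qed.

Lemma pair_of_sub b i : pair_of b i \subset tile_edges lg i.
Proof.
by apply/subsetP => e; rewrite /pair_of; case: b; rewrite !inE => /orP[]/eqP->;
  apply: imset_f.
Qed.

(** The sum modulo 2 equals the disjunction because the glued sides lie on different tiles; in this
    form it feeds [toggled_tiles] with [K] the singleton of [i]. *)
Lemma mem_tile_edges_linked i y z : linked (side_glue lg) y z ->
  (edge_of lg y \in tile_edges lg i) = (y.1 == i) (+) (z.1 == i).
Proof.
move=> hyz; have := linked_tiles hyz => ne.
apply/imsetP/idP => [[s _ /eqP]|].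
  rewrite edge_of_eq (same_edgeE _ _ (loop_simple hw)) => /orP[/eqP ey|hy].
    by move: ne; rewrite ey /= eqxx eq_sym => /negbTE->.
  have ez := loop_simple hw hyz hy.
  by move: ne; rewrite ez /= eqxx => /negbTE->.
case: eqP => [ey _|_ /= /eqP ez].
  by exists y.2; rewrite ?inE // -ey -surjective_pairing.
exists z.2; rewrite ?inE // -ez -surjective_pairing; apply/eqP.
by rewrite edge_of_eq (same_edgeE _ _ (loop_simple hw)) hyz orbT.
Qed.

Lemma mem_tile_edges_free i y : (forall z, ~~ linked (side_glue lg) y z) ->
  (edge_of lg y \in tile_edges lg i) = (y.1 == i).
Proof.
move=> hy; apply/imsetP/eqP => [[s _ /eqP]|<-]; last first.
  by exists y.2; rewrite ?inE // -surjective_pairing.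
by rewrite edge_of_eq => /(connect_unlinked hy) ->.
Qed.

(** No side of the pair on the tile [i] is lost by gluing: under [N'] the pattern on [i] is flipped,
    so compatibility of [N'] puts the partner of such a side in its pattern, and the partner's tile
    has the same pattern under [N]. *)
Lemma patched_tile N N' i (s : side) : compatible lg N' ->
  (forall j, (j \in N) (+) (j \in N') = (j == i)) ->
  patched lg N (i, s) = local N (i, s).
Proof.
move=> hN' hD; rewrite (patchedE _ _ (loop_simple hw)).
case hl: (local N (i, s)) => //=; apply/forallP => z; apply/implyP => hz.
have : local N' (i, s) || local N' z by case/orP: hz => /hN' //; rewrite orbC.
have := local_toggle N N' (i, s); rewrite hl hD eqxx; case: (local N' _) => //= _.
have := local_toggle N N' z; rewrite hD eq_sym (negbTE (linked_tiles hz)).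
by case: (local N z); case: (local N' z).
Qed.

Lemma twistE N1 N2 b i : compatible lg N1 -> compatible lg N2 ->
  twist lg i (pair_of b i) (pair_of (~~ b) i) (loop_matching N1) (loop_matching
    N2) <->
  (forall j, (j \in N1) (+) (j \in N2) = (j == i)) /\
  b = ~~ odd i (+) (i \in N1).
Proof.
move=> h1 h2.
have tileP (s : side) : edge_of lg (i, s) \in tile_edges lg i by apply: imset_f;
  rewrite inE.
split=> [/and3P[/eqP hoff /eqP hA /eqP hA']|[hD hb]].
  have inT1 (s : side) : patched lg N1 (i, s) = (s.1 == b).
    by rewrite -mem_loop_matching // -(mem_pair_of b i) -hA inE tileP andbT.
  have inT2 (s : side) : patched lg N2 (i, s) = (s.1 == ~~ b).
    by rewrite -mem_loop_matching // -(mem_pair_of (~~ b) i) -hA' inE tileP andbT.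
  (* As predicates on sides, the two matchings differ exactly on the edges of the tile [i]. *)
  have tog y : patched lg N1 y (+) patched lg N2 y = (edge_of lg y \in
    tile_edges lg i).
    case: (boolP (_ \in tile_edges _ _)) => [/imsetP[s _ /eqP]|hy].
      rewrite edge_of_eq => e; rewrite !(patched_same_edge _ e) inT1 inT2.
      by case: s.1; case: (b).
    have : (edge_of lg y \in loop_matching N1 :\: tile_edges lg i) =
           (edge_of lg y \in loop_matching N2 :\: tile_edges lg i) by rewrite hoff.
    by rewrite !inE hy !mem_loop_matching //= -/lg => ->; rewrite addbb.
  split.
    apply: toggled_tiles => // [y z hyz|y hy]; rewrite tog.
      exact: mem_tile_edges_linked.
    exact: mem_tile_edges_free.
  have := inT1 (b, true); rewrite eqxx => /forallP/(_ (i, (b, true))).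
  by rewrite /same_edge connect0 /local /=; case: (b); case: odd; case: (_ \in _).
have hD' j : (j \in N2) (+) (j \in N1) = (j == i) by rewrite addbC.
have inT1 (s : side) : patched lg N1 (i, s) = (s.1 == b).
  rewrite (patched_tile _ h2 hD) hb /local /=.
  by case: s.1; case: odd; case: (_ \in _).
have inT2 (s : side) : patched lg N2 (i, s) = (s.1 == ~~ b).
  rewrite (patched_tile _ h1 hD') hb /local /=; have := hD i; rewrite eqxx.
  by case: s.1; case: odd; case: (_ \in N1); case: (_ \in N2).
have restr N b' : (forall s : side, patched lg N (i, s) = (s.1 == b')) ->
    loop_matching N :&: tile_edges lg i = pair_of b' i.
  move=> h; apply/setP => e; rewrite inE;
    apply/andP/idP => [[he /imsetP[s _ ee]]|he].
    by move: he; rewrite ee mem_loop_matching h mem_pair_of.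
  have /imsetP[s _ ee] := subsetP (pair_of_sub b' i) _ he.
  by rewrite ee tileP mem_loop_matching // h -(mem_pair_of b' i) -ee.
apply/and3P; split; rewrite ?(restr _ _ inT1) ?(restr _ _ inT2) //.
(* An edge off the tile [i] has no side on it, and on all other tiles the two patterns coincide. *)
have off y : edge_of lg y \notin tile_edges lg i -> patched lg N1 y = patched
  lg N2 y.
  move=> hy; apply: eq_forallb => z; case hyz: same_edge => //=.
  have zi : z.1 != i.
    apply: contra hy => /eqP zi; apply/imsetP; exists z.2;
      rewrite ?inE // -zi -surjective_pairing.
    by apply/eqP; rewrite edge_of_eq.
  have := local_toggle N1 N2 z; rewrite hD (negbTE zi).
  by case: (local N1 z); case: (local N2 z).
apply/eqP/setP => e; rewrite !inE; case he: (e \in tile_edges _ _) => //=.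
apply/imsetP/imsetP => -[y hy ee]; exists y => //; move: he;
  rewrite ee => /negbT/off e'.
  by suff: patched lg N2 y by []; rewrite -e'.
by suff: patched lg N1 y by []; rewrite e'.
Qed.

Lemma matching_edgeE N1 N2 : compatible lg N1 -> compatible lg N2 ->
  matching_edge lg (loop_matching N1) (loop_matching N2) = differ_by_one N1 N2.
Proof.
move=> h1 h2; apply/existsP/cards1P => -[i].
  have toN b : (forall j, (j \in N1) (+) (j \in N2) = (j == i)) /\ b = ~~ odd i
    (+) (i \in N1) ->
      exists i, (N1 :\: N2) :|: (N2 :\: N1) = [set i].
    case=> hD _; exists i; apply/setP => j; rewrite !inE -hD.
    by case: (j \in N1); case: (j \in N2).
  by case/orP => h; [apply: (toN false)|apply: (toN true)]; apply/(twistE _ _ h1 h2).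
move=> e; exists i.
have hD j : (j \in N1) (+) (j \in N2) = (j == i).
  move/setP/(_ j): e; rewrite !inE => <-.
  by case: (j \in N1); case: (j \in N2).
case hb: (~~ odd i (+) (i \in N1)).
  by apply/orP; right; apply/(twistE true i h1 h2).
by apply/orP; left; apply/(twistE false i h1 h2).
Qed.

(** The starting pair in [twist_up] corresponds to [b = ~~ odd i]; the parity cancels against the
    one in [local], leaving [i \notin N1]. *)
Lemma twist_upE N1 N2 : compatible lg N1 -> compatible lg N2 ->
  twist_up lg (loop_matching N1) (loop_matching N2) <->
  exists2 i, i \notin N1 & N2 = i |: N1.
Proof.
move=> h1 h2.
have tw i : (if odd i then twist lg i (NS_pair lg i) (EW_pair lg i)
  (loop_matching N1) (loop_matching N2)
     else twist lg i (EW_pair lg i) (NS_pair lg i) (loop_matching N1)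
       (loop_matching N2)) <->
   (forall j, (j \in N1) (+) (j \in N2) = (j == i)) /\ ~~ odd i = ~~ odd i (+)
     (i \in N1).
  by rewrite -(twistE (~~ odd i) i h1 h2); case: (odd i).
split=> [/existsP[i /tw[hD hi]]|[i hi e]].
  have iN : i \notin N1 by move: hi; case: (odd i); case: (i \in N1).
  exists i => //; apply/setP => j; have := hD j; rewrite !inE.
  by case: eqP => [->|_]; rewrite ?(negbTE iN); case: (_ \in N1); case: (_ \in N2).
apply/existsP; exists i; apply/tw; rewrite (negbTE hi) addbF; split=> // j.
by rewrite e !inE; case: eqP => [->|_]; rewrite ?(negbTE hi) //=; case: (j \in N1).
Qed.

End Twists.

(** * Closed sets *)

Section Order.
Variable w : seq letter.
Hypothesis hw : is_loopword w.
Let n := (size w).+1.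
Let lg := loop_graph w.
Implicit Types (N : {set 'I_n}) (p q : 'I_n).

(** This is [identity_entry] with the names of the quiver arrows forgotten. It depends on the word
    only, so graph and module can be compared through it. *)
Definition successor (p q : nat) : bool :=
  [exists j : 'I_(size w), let d := is_direct (letter_at w j) in
     [|| goes d j j.+1 p q, left_loop w j && goes (~~ d) 0 j.+1 p q
       | right_loop w j && goes (~~ d) j (size w) p q]].

Definition successor_closed N : bool :=
  [forall p : 'I_n, forall q : 'I_n, successor p q ==> (p \in N) ==> (q \in N)].

Lemma successor_closedP N :
  reflect (forall p q : 'I_n, successor p q -> p \in N -> q \in N)
    (successor_closed N).
Proof.
apply: (iffP forallP) => [h p q hpq hp|h p].
  by move: (forallP (h p) q); rewrite hpq hp.
by apply/forallP => q; apply/implyP => hpq; apply/implyP/h.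
Qed.

Lemma right_loop_last (k : 'I_(size w)) : right_loop w k ->
  is_direct (letter_at w (size w).-1) = ~~ is_direct (letter_at w k).
Proof.
move=> rk; have [_ ks] := loop_bounds hw (proj1 (andP rk)).
by apply/opposite_arrow_direct/right_loop_opposite => //; lia.
Qed.

Lemma left_loop_first (k : 'I_(size w)) : left_loop w k ->
  is_direct (letter_at w 0) = ~~ is_direct (letter_at w k).
Proof.
move=> lk; have [k0 _] := loop_bounds hw (proj1 (andP lk)).
by apply/opposite_arrow_direct/left_loop_opposite.
Qed.

Definition arrow_ok (d : bool) (x y : 'I_n) N : bool :=
  if d then (x \in N) ==> (y \in N) else (y \in N) ==> (x \in N).

Lemma arrow_okP d (x y : 'I_n) N :
  reflect (forall p q : 'I_n, goes d x y p q -> p \in N -> q \in N) (arrow_ok d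
    x y N).
Proof.
have e (i j : 'I_n) : (i == j :> nat) -> i = j by move/eqP/val_inj.
apply: (iffP idP) => [|h].
  by rewrite /goes /arrow_ok; case: d => /implyP h p q /andP[/e-> /e->].
by rewrite /arrow_ok; case: d h => h; apply/implyP; apply: h; rewrite /goes !eqxx.
Qed.

(** The glued sides are parallel and their tiles have opposite parities, so one pattern is
    membership and the other its negation: their disjunction is an implication. [on_right] compares
    parity with direction, so only the direction of the letter survives. *)
Lemma local_snake (k : nat) N : k < size w ->
  local N (exit_side w k) || local N (entry_side w k) =
  arrow_ok (is_direct (letter_at w k)) (inord k) (inord k.+1) N.
Proof.
move=> hk; rewrite /local /arrow_ok /exit_side /entry_side /= !inordK //;
  last exact: ltnW.
by rewrite /on_right /=; case: is_direct; case: (odd k) => /=; case: (_ \in N);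
  case: (_ \in N).
Qed.

(** The looped side of the tile [k] is perpendicular to its exit side, which reverses the role of
    [k] in the implication. On the last tile the looped side is parallel to the entry side, whose
    letter is opposite to the loop. *)
Lemma local_right (k : 'I_(size w)) N : right_loop w k ->
  local N (ord_max, (right_loop_sides w k).1) ||
  local N (inord k, (right_loop_sides w k).2) =
  arrow_ok (~~ is_direct (letter_at w k)) (inord k) ord_max N.
Proof.
move=> rk; have hk := ltn_ord k;
  rewrite /local /arrow_ok /right_loop_sides /= inordK; last exact: ltnW.
rewrite /on_right (right_loop_last rk); have -> : odd (size w).-1 = ~~ odd (size w).
  by rewrite -[in RHS](prednK (leq_ltn_trans (leq0n k) hk)) /= negbK.
by case: is_direct; case: (odd k); case: odd => /=; case: (_ \in N); case: (_ \in N).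
Qed.

Lemma local_left (k : 'I_(size w)) N : left_loop w k ->
  local N (ord0, (left_loop_sides w k).1) ||
  local N (inord k.+1, (left_loop_sides w k).2) =
  arrow_ok (~~ is_direct (letter_at w k)) ord0 (inord k.+1) N.
Proof.
move=> lk; have hk := ltn_ord k;
  rewrite /local /arrow_ok /left_loop_sides /= inordK //.
rewrite /on_right (left_loop_first lk) /=.
by case: is_direct; case: (odd k) => /=; case: (_ \in N); case: (_ \in N).
Qed.

Lemma compatible_closed N : compatible lg N <-> successor_closed N.
Proof.
split=> [hN|/successor_closedP hN].
  apply/successor_closedP => p q /existsP[j] /=.
  have hj := ltn_ord j; have hj' : j < n by apply: ltnW.
  case/or3P=> [|/andP[lj]|/andP[rj]].
  - have := hN _ _ (exit_entry_glued hj); rewrite local_snake // => /arrow_okP h g.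
    by apply: h; rewrite !inordK.
  - have := local_left N lj; rewrite hN => [/esym/arrow_okP h g|].
      by apply: h; rewrite inordK.
    by rewrite (step_sides (left_step hw lj)) !eqxx orbT.
  have := local_right N rj; rewrite hN => [/esym/arrow_okP h g|].
    by apply: h; rewrite inordK.
  by have := step_sides (right_step hw rj); rewrite /= loop_sidesE orbA => ->;
    rewrite !eqxx orbT.
have suc (j : 'I_(size w)) : let d := is_direct (letter_at w j) in
   [/\ arrow_ok d (inord j) (inord j.+1) N,
       left_loop w j -> arrow_ok (~~ d) ord0 (inord j.+1) N
     & right_loop w j -> arrow_ok (~~ d) (inord j) ord_max N].
  have hj := ltn_ord j; have hj' : j < n by apply: ltnW.
  move=> d; split=> [|lj|rj]; apply/arrow_okP => p q; rewrite ?inordK // => g;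
    apply: hN; apply/existsP; exists j; rewrite /= ?lj ?rj /= -/d ?g ?orbT //.
move=> y z; rewrite /= loop_sidesE => /or3P[|/existsP[k]|/existsP[k]].
- case: y z => [i q] [j r] /andP[/= /eqP ej eqr].
  have hi : i < size w by rewrite -ltnS -ej ltn_ord.
  have -> : j = inord i.+1 by apply: val_inj; rewrite /= inordK.
  have [+ _ _] := suc (Ordinal hi);
    rewrite /= -local_snake // /exit_side /entry_side.
  by rewrite inord_val; move: eqr; case: on_right => /eqP[-> ->].
- case: y z => [i q] [j r] /and4P[rk /= /eqP ei /eqP ej /eqP[-> ->]].
  have -> : i = ord_max by apply: val_inj.
  have -> : j = inord k by apply: val_inj; rewrite /= inordK // ltnS ltnW.
  by have [_ _ /(_ rk)] := suc k; rewrite -local_right.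
case: y z => [i q] [j r] /and4P[lk /= /eqP ei /eqP ej /eqP[-> ->]].
have -> : i = ord0 by apply: val_inj.
have -> : j = inord k.+1 by apply: val_inj; rewrite /= inordK ?ltnS.
by have [_ /(_ lk) + _] := suc k; rewrite -local_left.
Qed.

(* Arrows lower the rank by 2 and loops only by 1: the arrow added by a loop then
   lowers it too, since the loop is bypassed by at least one arrow. *)
Fixpoint rank (i : nat) : int :=
  if i is j.+1 then
    let c := if is_loop (letter_at w j) then Posz 1 else Posz 2 in
    (if is_direct (letter_at w j) then rank j - c else rank j + c)%R
  else 0%R.

Lemma rankS i : rank i.+1 =
  (if is_direct (letter_at w i) then rank i - (if is_loop (letter_at w i) then
    Posz 1 else Posz 2)
   else rank i + (if is_loop (letter_at w i) then Posz 1 else Posz 2))%R.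
Proof. by []. Qed.

Lemma rank_left (k : 'I_(size w)) i : left_loop w k -> i <= k ->
  rank i = (if is_direct (letter_at w k) then Posz (2 * i)%N else - Posz (2 *
    i)%N)%R.
Proof.
move=> lk; elim: i => [|i IH] hi; first by rewrite /=; case: is_direct.
have ho := left_loop_opposite lk (ltn_ord k) hi.
rewrite /= (opposite_arrow_loop ho) (opposite_arrow_direct ho) IH; last exact: ltnW.
by case: is_direct => /=; lia.
Qed.

Lemma rank_right (k : 'I_(size w)) i : right_loop w k -> k.+1 + i <= size w ->
  rank (k.+1 + i) = (if is_direct (letter_at w k) then rank k.+1 + Posz (2 * i)%N
                     else rank k.+1 - Posz (2 * i)%N)%R.
Proof.
move=> rk; elim: i => [|i IH] hi; first by rewrite addn0; case: is_direct; lia.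
have ki : k < k.+1 + i by lia.
have hi' : k.+1 + i < size w by lia.
have ho := right_loop_opposite rk ki hi'.
rewrite addnS rankS (opposite_arrow_loop ho) (opposite_arrow_direct ho) IH;
  last exact: ltnW.
by case: is_direct => /=; lia.
Qed.

Lemma successor_rank p q : successor p q -> (rank q < rank p)%R.
Proof.
case/existsP=> j /= /or3P[|/andP[lj]|/andP[rj]].
- by rewrite /goes; case dj: is_direct => /andP[/eqP-> /eqP->] /=; rewrite dj;
    case: is_loop; lia.
(* The rank is 0 at the first tile, [2 * j] up to sign at [j], and the loop letter takes back only
   1; as [0 < j], the sign persists at [j.+1]. *)
- have [j0 _] := loop_bounds hw (proj1 (andP lj)).
  have e := rank_left lj (leqnn j); have := proj1 (andP lj) => il.
  by rewrite /goes; case dj: is_direct e => /= e /andP[/eqP-> /eqP->] /=;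
    rewrite dj il e; lia.
have [_ js] := loop_bounds hw (proj1 (andP rj)); have il := proj1 (andP rj).
have := @rank_right j (size w - j.+1) rj; rewrite subnKC // => /(_ (leqnn _)) /=.
by rewrite il /goes; case dj: is_direct => /= e /andP[/eqP-> /eqP->]; rewrite e; lia.
Qed.

(** An element of [N' :\: N] of least rank can be added: its successors lie in [N'] and have smaller
    rank, hence are already in [N]. *)
Lemma closed_extend N N' : successor_closed N -> successor_closed N' ->
  N \proper N' -> exists2 i, i \in N' :\: N & successor_closed (i |: N).
Proof.
move=> /successor_closedP hN /successor_closedP hN' /properP[sN [i0 hi0 hi0']].
have h0 : i0 \in N' :\: N by rewrite inE hi0 hi0'.
have [i hi imin] : exists2 i, i \in N' :\: N &
    forall q, q \in N' :\: N -> (rank i <= rank q)%R.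
  have [i hi imin] := Order.TotalTheory.arg_minP (P := mem (N' :\: N)) (fun i :
    'I_n => rank i) h0.
  by exists i.
exists i => //; apply/successor_closedP => p q hpq; rewrite !inE.
case/orP=> [/eqP ep|hp]; last by rewrite (hN p q) ?orbT.
rewrite {p}ep in hpq.
have hq : q \in N' by move: hi; rewrite inE => /andP[_ /(hN' _ _ hpq)].
apply/orP; right; apply: contraT => hq'.
have := imin q; rewrite inE hq hq' => /(_ isT).
by have := successor_rank hpq; lia.
Qed.

Lemma matching_leE N N' : successor_closed N -> successor_closed N' ->
  matching_le w (loop_matching N) (loop_matching N') = (N \subset N').
Proof.
move=> hN hN'; apply/idP/idP => [|].
  case/connectP => s; elim: s N hN => [|P s IH] N hN /=.
    by move=> _ /loop_matching_inj e; rewrite (e hw) //; apply/compatible_closed.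
  case/andP=> /and3P[_ /(good_matchingP hw)[N1 /compatible_closed h1 ->]].
  move=> /twist_upE tw hs hl; apply: subset_trans (IH _ h1 hs hl).
  have [||i _ ->] := tw hw; first exact/compatible_closed.
    exact/compatible_closed.
  exact: subsetUr.
move: {2}(#|N' :\: N|) (erefl #|N' :\: N|) => m.
elim: m N hN => [|m IH] N hN hm sN.
  have -> : N = N'.
    by apply/eqP; rewrite eqEsubset sN -setD_eq0 -cards_eq0 hm.
  exact: connect0.
have pN : N \proper N' by rewrite properE sN -setD_eq0 -cards_eq0 hm.
have [i] := closed_extend hN hN' pN; rewrite inE => /andP[iN iN'] hi.
apply: connect_trans (connect1 _) (IH _ hi _ _); last 1 first.
- by rewrite subUset sub1set iN'.
- have g M : successor_closed M -> good_matching w (loop_matching M).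
    by move=> hM; apply/(good_matchingP hw); exists M => //; apply/compatible_closed.
  rewrite !g //=; apply/twist_upE => //; try exact/compatible_closed.
  by exists i.
have : #|N' :\: (i |: N)|.+1 = #|N' :\: N|.
  rewrite (cardsD1 i (N' :\: N)) inE iN iN' add1n; congr _.+1.
  by apply: eq_card => j; rewrite !inE negb_or andbA.
by rewrite hm => -[].
Qed.

End Order.

(** * Canonical submodules *)

Section CanonicalSubmodules.
Local Open Scope ring_scope.
Import GRing.Theory.
Variables (k : fieldType) (Q : quiver) (w : loopstring Q).
Let n := (size (word w)).+1.
Implicit Types (N : {set 'I_n}) (p q : 'I_n).

Lemma successorP p q :
  reflect (exists a, identity_entry a p q) (successor (word w) p q).
Proof.
apply: (iffP existsP) => [[j /= /or3P[h|/andP[lj h]|/andP[rj h]]]|].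
- by exists (arrow j); apply/existsP; exists j; rewrite /= eqxx h.
- by exists (larrow j); apply/existsP; exists j; rewrite /= eqxx lj h orbT.
- by exists (rarrow j); apply/existsP; exists j; rewrite /= eqxx rj h !orbT.
case=> a /existsP[j /= /or3P[/andP[_ h]|/and3P[lj _ h]|/and3P[rj _ h]]];
  by exists j; rewrite /= ?lj ?rj h ?orbT.
Qed.

Lemma goes_src a (d : bool) (x y : 'I_n) p q :
  joins a d (vertex_at x) (vertex_at y) -> goes d x y p q -> vertex_at p = src a.
Proof.
by rewrite /joins /goes; case: d => -[e _] /andP[/eqP/val_inj-> _]; rewrite e.
Qed.

(** Ensures that the vertex projection at the start of a one-arrow path does not kill the basis
    vector [p]. *)
Lemma identity_entry_src a p q : identity_entry a p q -> vertex_at p = src a.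
Proof.
case/existsP=> j /=; have hj := ltn_ord j; have hj' : (j < n)%N by apply: ltnW.
case/or3P=> [/andP[/eqP<-]|/and3P[lj /eqP<-]|/and3P[rj /eqP<-]] h.
- by apply: (goes_src (arrowP j)); rewrite !inordK; eauto.
- by apply: (goes_src (larrowP lj)); rewrite inordK; eauto.
by apply: (goes_src (rarrowP rj)); rewrite inordK; eauto.
Qed.

Definition coord_mx N : 'M[k]_n :=
  (\sum_(i in N) <<delta_mx 0 i : 'rV[k]_n>>)%MS.

Lemma sub_coord_mx N m (A : 'M[k]_(m, n)) :
  (A <= coord_mx N)%MS = [forall r, forall q, (q \notin N) ==> (A r q == 0)].
Proof.
(* The row space of this 0-1 diagonal matrix is the coordinate subspace, which turns inclusion into
   vanishing of entries. *)
pose D : 'M[k]_n := diag_mx (\row_q (q \in N)%:R).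
have e : (coord_mx N :=: D)%MS.
  apply/eqmxP/andP; split.
    apply/sumsmx_subP => i hi; rewrite genmxE.
    apply/submxP; exists (delta_mx 0 i); rewrite -rowE.
    by rewrite row_diag_mx mxE hi scale1r.
  apply/row_subP => i; rewrite row_diag_mx mxE.
  case hi: (i \in N); last by rewrite scale0r sub0mx.
  by rewrite scale1r (sumsmx_sup i) // genmxE.
rewrite e; apply/idP/forallP => [/submxP[B ->] r|h].
  apply/forallP => q; apply/implyP => hq; rewrite mul_mx_diag mxE mxE (negbTE hq).
  by rewrite mulr0.
apply/submxP; exists A; apply/matrixP => r q; rewrite mul_mx_diag !mxE.
case hq: (q \in N); first by rewrite mulr1.
by rewrite mulr0; apply/eqP; have := forallP (h r) q; rewrite hq.
Qed.

Lemma coord_mx_stable N (A : 'M[k]_n) :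
  reflect (forall p q, p \in N -> q \notin N -> A p q = 0) (stablemx (coord_mx N) A).
Proof.
apply: (iffP idP) => [hA p q hp hq|hA].
  have sp : ((delta_mx 0 p : 'rV[k]_n) <= coord_mx N)%MS.
    by rewrite (sumsmx_sup p) // genmxE.
  have := submx_trans (submxMr A sp) hA; rewrite -rowE sub_coord_mx.
  by move/forallP/(_ 0)/forallP/(_ q); rewrite hq mxE => /eqP.
rewrite sumsmxMr; apply/sumsmx_subP => p hp.
rewrite (eqmxMr _ (genmxE _)) -rowE sub_coord_mx.
apply/forallP => r; apply/forallP => q; apply/implyP => hq.
by rewrite mxE hA.
Qed.

Lemma canonical_submoduleP N :
  canonical_submodule k w N <-> successor_closed N.
Proof.
split=> [hN|/successor_closedP hN x].
  apply/successor_closedP => p q /successorP[a ha] hp; apply: contraT => hq.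
  have hs : composable (src a) [:: a] by rewrite /= eqxx.
  (* The matrix of the path consisting of [a] alone has entry 1 at [(p, q)], which stability forbids
     when [p] is in [N] and [q] is not. *)
  pose pa : qpath Q := exist _ (src a, [:: a]) hs.
  have /coord_mx_stable/(_ p q hp hq) := hN << pa >>.
  rewrite /action_mx msuppU oner_eq0 big_seq_fset1 mcoeffU eqxx scale1r /path_mx /=.
  rewrite mxE (bigD1 p) //= big1 => [|r rp].
    rewrite !mxE eqxx ha (identity_entry_src ha) /path_src /= eqxx mulr1 addr0.
    by move/eqP; rewrite oner_eq0.
  by rewrite mxE eq_sym (negbTE rp) mul0r.
(* Conversely, elements of the path algebra act by linear combinations of products of vertex and
   arrow matrices, so these generators suffice. *)
have stA a : stablemx (coord_mx N) (arrow_mx k w a).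
  apply/coord_mx_stable => p q hp hq; rewrite mxE.
  case ha: identity_entry => //; move: hq; rewrite (hN p q) //.
  by apply/successorP; exists a.
have stV v : stablemx (coord_mx N) (vertex_mx k w v).
  apply/coord_mx_stable => p q hp hq; rewrite mxE.
  by case: eqP => // e; rewrite -e hp in hq.
have stP r : stablemx (coord_mx N) (path_mx k w r).
  rewrite /path_mx; elim: (path_arrows r) (vertex_mx _ _ _) (stV (path_src r))
    => //= a s IH A hA.
  by apply: IH; apply: stablemxM.
apply: (big_ind (fun A => stablemx (coord_mx N) A)) => [|A B|r _].
- exact: stablemx0.
- exact: stablemxD.
by rewrite -mul_scalar_mx; apply: stablemxM => //; apply: stablemxC.
Qed.

End CanonicalSubmodules.

Theorem theorem1p0p1 (k : closedFieldType) (Q : quiver)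
    (I : {malg k[qpath Q]} -> Prop) (hI : admissible I)
    (w : loopstring Q) (hM : module_over w I) :
  exists f : {set {set 'I_(size (word w)).+1 * side}} ->
             {set 'I_(size (word w)).+1},
    [/\ bijection_between (good_matching (word w)) (canonical_submodule k w) f,
        forall P P', good_matching (word w) P -> good_matching (word w) P' ->
          matching_le (word w) P P' = (f P \subset f P')
      & forall P P', good_matching (word w) P -> good_matching (word w) P' ->
          matching_edge (loop_graph (word w)) P P' = differ_by_one (f P) (f P')].
Proof.
have hw := wordP w.
(* [f] inverts [loop_matching]; the default [set0] is reached only when [P] is not good. *)
pose f (P : {set {set 'I_(size (word w)).+1 * side}}) : {set 'I_(size (word
  w)).+1} :=
  odflt set0 [pick N | successor_closed N & loop_matching N == P].
have goodE P : good_matching (word w) P <->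
    exists2 N, successor_closed N & P = loop_matching N.
  by rewrite good_matchingP //; split=> -[N /(compatible_closed hw) hN ->]; exists N.
have fK N : successor_closed N -> f (loop_matching N) = N.
  move=> hN; rewrite /f; case: pickP => [N' /andP[hN' /eqP e]|/(_ N)] /=.
    by apply: loop_matching_inj e => //; apply/compatible_closed.
  by rewrite hN eqxx.
exists f; split.
- split=> [P /goodE[N hN ->]|P P' /goodE[N hN ->] /goodE[N' hN' ->]|N].
  + by rewrite fK //; apply/canonical_submoduleP.
  + by rewrite !fK // => ->.
  move/canonical_submoduleP => hN; exists (loop_matching N); last exact: fK.
  by apply/goodE; exists N.
- by move=> P P' /goodE[N hN ->] /goodE[N' hN' ->]; rewrite !fK // matching_leE.
move=> P P' /goodE[N hN ->] /goodE[N' hN' ->]; rewrite !fK // matching_edgeE //;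
  exact/compatible_closed.
Qed.
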